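(* Let $G$ be a finite, connected, loopless undirected graph (multiple edges allowed). For every integer $d\ge1$, the $d$-matching polynomial $\mathcal{M}_{d,G}$ of $G$ is real rooted with all its roots contained in the interval $[-\rho(G),\rho(G)]$, where $\rho(G)$ is the spectral radius of the universal covering tree of $G$.
   Context: For a finite connected graph $G$ with universal covering tree $T$, $\rho(G)$ denotes the spectral radius of the adjacency operator $(A_Tf)(v)=\sum_{u\sim v}f(u)$ acting on $\ell^2(V(T))$. Orient each edge of $G$ arbitrarily; $E^+(G)$ is the resulting set of oriented edges, $E^-(G)$ the set of their reverses, $E(G)=E^+(G)\sqcup E^-(G)$, $-e$ is the reverse of $e$, and $h(e),t(e)$ are the head and tail of $e$. $\mathcal{C}_{d,G}$ is the set of functions $\sigma:E(G)\to S_d$ with $\sigma(-e)=\sigma(e)^{-1}$, with uniform distribution; $\sigma$ is identified with the graph $H$ (a $d$-covering of $G$) with vertex set $\{v_i:v\in V(G),1\le i\le d\}$ which has, for each $e\in E^+(G)$, the $d$ edges joining $t(e)_i$ to $h(e)_{\sigma(e)(i)}$, $1\le i\le d$. The matching polynomial of a finite graph $H$ on $N$ vertices is $\mathcal{M}_H(x)=\sum_{i=0}^{\lfloor N/2\rfloor}(-1)^i m_i x^{N-2i}$, where $m_i$ is the number of matchings in $H$ with $i$ edges (parallel edges regarded as distinct) and $m_0=1$. The $d$-matching polynomial of $G$ is $\mathcal{M}_{d,G}(x)=\mathbb{E}_{H\in\mathcal{C}_{d,G}}[\mathcal{M}_H(x)]$, the average of the matching polynomials of all $d$-coverings of $G$.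 *)

(* Defs.v *)
From mathcomp Require Import all_boot all_order all_algebra all_fingroup.
From mathcomp Require Import all_classical all_reals all_analysis.
From mathcomp Require Import complex.

Set Implicit Arguments.
Unset Strict Implicit.
Unset Printing Implicit Defensive.

Import Order.TTheory GRing.Theory Num.Theory.

Local Open Scope classical_set_scope.
Local Open Scope ring_scope.

(* A finite undirected multigraph, given with an arbitrary orientation of its
   edges: [gedge] is E^+(G), and e : gedge goes from [etail e] to [ehead e].
   Loops and parallel edges are allowed. *)
Record mgraph := MGraph {
  vert : finType;
  gedge : finType;
  etail : gedge -> vert;
  ehead : gedge -> vert }.

Definition loopless (G : mgraph) : Prop :=
  forall e : gedge G, etail e != ehead e.

Definition gadj (G : mgraph) : rel (vert G) := fun u v =>
  [exists e : gedge G, ((etail e == u) && (ehead e == v))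
                       || ((etail e == v) && (ehead e == u))].

(* Nonemptiness is not included: a base vertex is always given separately. *)
Definition gconnected (G : mgraph) : Prop :=
  forall u v : vert G, connect (@gadj G) u v.

(* The set E(G) of oriented edges: (e, true) is e itself and (e, false) is its
   reverse. *)
Definition dart (G : mgraph) : finType := (gedge G * bool)%type.
Definition drev (G : mgraph) (a : dart G) : dart G := (a.1, ~~ a.2).
Definition dtail (G : mgraph) (a : dart G) : vert G :=
  if a.2 then etail a.1 else ehead a.1.
Definition dhead (G : mgraph) (a : dart G) : vert G :=
  if a.2 then ehead a.1 else etail a.1.

Definition coverings (d : nat) (G : mgraph) : {set {ffun dart G -> 'S_d}} :=
  [set s : {ffun dart G -> 'S_d} |
    [forall a : dart G, s (drev a) == ((s a)^-1)%g]]%SET.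

(* The edge (e, i) joins t(e)_i to h(e)_{s(e)(i)}. *)
Definition covering_graph (d : nat) (G : mgraph) (s : {ffun dart G -> 'S_d}) :
    mgraph :=
  @MGraph (vert G * 'I_d)%type (gedge G * 'I_d)%type
    (fun x => (etail x.1, x.2))
    (fun x => (ehead x.1, s (x.1, true) x.2)).

Definition endpoints (H : mgraph) (e : gedge H) : {set vert H} :=
  [set etail e; ehead e]%SET.

Definition is_matching (H : mgraph) (M : {set gedge H}) : bool :=
  [forall e in M, forall f in M,
    (e != f) ==> [disjoint endpoints e & endpoints f]].

Definition nmatchings (H : mgraph) (i : nat) : nat :=
  #|[set M : {set gedge H} | is_matching M && (#|M| == i)]%SET|.

Definition matching_poly (R : nzRingType) (H : mgraph) : {poly R} :=
  \sum_(i < (#|vert H|./2).+1)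
    ((-1) ^+ i * (nmatchings H i)%:R) *: 'X^(#|vert H| - 2 * i).

Definition d_matching_poly (R : fieldType) (d : nat) (G : mgraph) : {poly R} :=
  (#|coverings d G|%:R)^-1 *:
    \sum_(s in coverings d G) matching_poly R (covering_graph s).

(* The universal covering tree: its vertices are the non-backtracking walks of
   G starting at a base vertex x, and two of them are adjacent when one extends
   the other by a single oriented edge. *)
Fixpoint is_walk (G : mgraph) (x : vert G) (w : seq (dart G)) : bool :=
  if w is a :: w' then (dtail a == x) && is_walk (dhead a) w' else true.

Definition nb_walk (G : mgraph) (x : vert G) (w : seq (dart G)) : bool :=
  is_walk x w && sorted (fun a b => b != drev a) w.

Definition utree (G : mgraph) (x : vert G) : choiceType :=
  {w : seq (dart G) | nb_walk x w}.

Definition utree_adj (G : mgraph) (x : vert G) : rel (utree x) := fun u v =>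
  [exists a : dart G,
    (val v == rcons (val u) a) || (val u == rcons (val v) a)].

Section SpectralRadius.
Variables (R : realType) (T : choiceType).
Implicit Types (f g : T -> R[i]) (A B : (T -> R[i]) -> (T -> R[i])).

Definition l2norm_sqr f : \bar R :=
  \esum_(v in [set: T]) (ComplexField.Normc.normc (f v) ^+ 2)%:E.

Definition in_l2 f : Prop := (l2norm_sqr f < +oo)%E.

(* Operators are total functions on T -> C; only their values on the
   square-summable functions matter. *)
Definition bounded_l2_operator B : Prop :=
  (forall (c : R[i]) f g, in_l2 f -> in_l2 g ->
     forall v, B (fun u => c * f u + g u) v = c * B f v + B g v) /\
  (exists M : R, forall f, in_l2 f ->
     (l2norm_sqr (B f) <= M%:E * l2norm_sqr f)%E).

(* A - z has a bounded inverse on l^2. *)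
Definition in_resolvent A (z : R[i]) : Prop :=
  exists B, [/\ bounded_l2_operator B,
    (forall f, in_l2 f -> forall v, A (B f) v - z * B f v = f v) &
    (forall f, in_l2 f -> forall v, B (fun u => A f u - z * f u) v = f v)].

Definition spectrum A : set R[i] := [set z | ~ in_resolvent A z].

Definition spectral_radius A : \bar R :=
  ereal_sup [set (ComplexField.Normc.normc z)%:E | z in spectrum A].

(* The sum is a finitely supported one: the adjacency operator is meant for
   locally finite graphs. *)
Definition adj_operator (r : rel T) f : T -> R[i] :=
  fun v => \sum_(u \in [set u | r u v]) f u.

End SpectralRadius.

(* rho(G), computed on the universal covering tree based at x. *)
Definition rho (R : realType) (G : mgraph) (x : vert G) : \bar R :=
  spectral_radius (@adj_operator R (utree x) (@utree_adj G x)).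

Definition real_rooted (R : realType) (p : {poly R}) : Prop :=
  forall z : R[i], root (map_poly (real_complex R) p) z -> complex.Im z = 0.

(* Main.v *)
(* Write M_H(x), with one variable per vertex, for the sum over the matchings of
   H of (-1)^(number of edges) times the product of the variables of the
   uncovered vertices.

   Real-rootedness. M_H is obtained from the product of all variables by
   applying 1 - d_u d_v for every edge uv, and these operators preserve
   nonvanishing on the upper half-plane. Averaging over the permutation of one
   edge e of G amounts, because everything is symmetric in each fibre, to
   applying the operators for the identity permutation and symmetrizing over
   the fibre of the head of e; symmetrization preserves nonvanishing by the
   Grace-Walsh-Szego theorem, which follows from Laguerre's theorem on polar
   derivatives. Inserting the edges of G one by one, the average of M_H does
   not vanish on the upper half-plane, hence has only real zeros on the diagonal.

   Bound. Each single M_H(x) is positive for x > rho: the top of the numerical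
   range of A_T lies in the spectrum, so x - A_T is positive definite on finitely
   supported functions; testing it on a product of the ratios
   r_a = 1 / (x - sum of r_b over the darts b following a), truncated at finite
   depth, shows that all the denominators are positive, and the same recursion
   bounds M_(H - v) / M_H. Parity gives the lower bound. *)

Require Import Defs.
From mathcomp Require Import all_boot all_order all_algebra all_fingroup.
From mathcomp Require Import all_classical all_reals all_analysis.
From mathcomp Require Import complex.
From mathcomp Require Import ring lra.

Set Implicit Arguments.
Unset Strict Implicit.
Unset Printing Implicit Defensive.

Import Order.TTheory GRing.Theory Num.Theory.
Local Open Scope ring_scope.

(** * Multiaffine polynomials without zeros in the upper half-plane *)

(* A polynomial is represented by its evaluation function; on multiaffine
   functions [dif w] is then the partial derivative, and [edge_op u v] is
   1 - d_u d_v. *)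
Section Multiaffine.
Variables (W : finType) (K : comNzRingType).
Implicit Types (x : W -> K) (P : (W -> K) -> K).

Definition upd x w t : W -> K := fun w' => if w' == w then t else x w'.

Definition dif w P : (W -> K) -> K := fun x => P (upd x w 1) - P (upd x w 0).

Definition multiaffine P :=
  forall w x t, P (upd x w t) = P (upd x w 0) + t * dif w P x.

Definition edge_op u v P : (W -> K) -> K := fun x => P x - dif u (dif v P) x.

Lemma updT x w t t' : upd (upd x w t) w t' = upd x w t'.
Proof. by apply/funext => w'; rewrite /upd; case: eqP. Qed.

Lemma updC x w w' t t' : w != w' ->
  upd (upd x w t) w' t' = upd (upd x w' t') w t.
Proof.
move=> ww'; apply/funext => z; rewrite /upd.
by case: (eqVneq z w') => [->|//]; rewrite eq_sym (negPf ww').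
Qed.

Lemma upd_id x w : upd x w (x w) = x.
Proof. by apply/funext => z; rewrite /upd; case: eqP => [->|]. Qed.

Lemma dif_upd w P x t : dif w P (upd x w t) = dif w P x.
Proof. by rewrite /dif !updT. Qed.

Lemma difC u v P : dif u (dif v P) = dif v (dif u P).
Proof.
have [->//|uv] := eqVneq u v.
by apply/funext => x; rewrite /dif !(updC _ _ _ uv); ring.
Qed.

Lemma multiaffine_dif u P : multiaffine P -> multiaffine (dif u P).
Proof.
move=> affP w x t; have [->|wu] := eqVneq w u.
  by rewrite /dif !updT subrr mulr0 addr0.
rewrite [in LHS]/dif !(updC _ _ _ wu) affP (affP _ (upd x u 0)).
by rewrite /dif !(updC _ _ _ wu); ring.
Qed.

Lemma multiaffine_edge_op u v P : multiaffine P -> multiaffine (edge_op u v P).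
Proof.
move=> affP w x t.
have affD := multiaffine_dif u (multiaffine_dif v affP).
have -> : dif w (edge_op u v P) x = dif w P x - dif w (dif u (dif v P)) x.
  by rewrite /edge_op /dif; ring.
by rewrite /edge_op affP affD; ring.
Qed.

Lemma multiaffine_sum (I : finType) (P : I -> (W -> K) -> K) :
  (forall i, multiaffine (P i)) -> multiaffine (fun x => \sum_i P i x).
Proof.
move=> affP w x t; rewrite /dif -sumrB mulr_sumr -big_split.
by apply: eq_bigr => i _; rewrite affP.
Qed.

Lemma multiaffine_rename (g : W -> W) P : injective g -> multiaffine P ->
  multiaffine (fun x => P (x \o g)).
Proof.
move=> gI affP w x t.
have [g' gK g'K] := injF_bij gI.
have updg y s : upd y w s \o g = upd (y \o g) (g' w) s.
  by apply/funext => z; rewrite /upd /= (can2_eq gK g'K).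
by rewrite /dif !updg; apply: affP.
Qed.

Definition edge_ops (es : seq (W * W)) P := foldr (fun e => edge_op e.1 e.2) P es.

Lemma multiaffine_edge_ops es P : multiaffine P -> multiaffine (edge_ops es P).
Proof. by move=> affP; elim: es => //= e es IH; apply: multiaffine_edge_op. Qed.

Lemma edge_ops_sum (I : finType) es (P : I -> (W -> K) -> K) :
  edge_ops es (fun x => \sum_i P i x) = fun x => \sum_i edge_ops es (P i) x.
Proof.
elim: es => //= e es ->; apply/funext => x.
by rewrite /edge_op /dif -!sumrB.
Qed.

Lemma edge_ops_rename (g : W -> W) es P x : injective g ->
  edge_ops es P (x \o g) =
  edge_ops [seq (g e.1, g e.2) | e <- es] (fun y => P (y \o g)) x.
Proof.
move=> gI; elim: es x => //= e es IH x.
have updg y w s : upd (y \o g) w s = upd y (g w) s \o g.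
  by apply/funext => z; rewrite /upd /= (inj_eq gI).
by rewrite /edge_op /dif !updg !IH.
Qed.

End Multiaffine.

(** * Biaffine functions without zeros on the upper half-plane *)

Section Stability.
Variable (R : rcfType).
Local Notation C := R[i].
Implicit Types (a b c e y z : C).

Lemma ImM a b : complex.Im (a * b) =
  complex.Re a * complex.Im b + complex.Im a * complex.Re b.
Proof. by case: a b => [a1 a2] [b1 b2]; rewrite /= addrC [a2 * _]mulrC; ring. Qed.

Lemma ImD a b : complex.Im (a + b) = complex.Im a + complex.Im b.
Proof. by rewrite raddfD. Qed.

Lemma ImV a : complex.Im a^-1 =
  - complex.Im a / (complex.Re a ^+ 2 + complex.Im a ^+ 2).
Proof. by case: a => p q; rewrite /= mulNr. Qed.

Lemma ImN_inv_gt0 a : 0 < complex.Im a -> 0 < complex.Im (- a^-1).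
Proof.
move=> a0; rewrite raddfN /= ImV mulNr opprK divr_gt0 // ltr_wpDl ?sqr_ge0 //.
by rewrite exprn_gt0.
Qed.

(* Otherwise [x |-> F(x, y)] has, for [y] near [- b / e], a zero escaping to
   infinity in any prescribed direction. *)
Lemma biaffine_pole a b c e :
  (forall x y, 0 < complex.Im x -> 0 < complex.Im y ->
    a + b * x + c * y + e * x * y != 0) ->
  e != 0 -> complex.Im (- b / e) <= 0.
Proof.
move=> F0 e0; rewrite leNgt; apply/negP; set y0 := - b / e => Iy0.
set k := a + c * y0.
have be : b = - (e * y0) by rewrite /y0; field.
have k0 : k != 0.
  by have := F0 'i%C y0 ltr01 Iy0; rewrite be /k; congr (_ != 0); ring.
(* With [b = - (e * y0)] the function equals [k + e * (x + c / e) * (y - y0)]. It vanishes at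
   [x = - c / e + N i], [y = y0 + (k / e) i / N]. The value of [N] is large enough to put both
   points in the upper half-plane. *)
set m := - complex.Im (c / e); set n := complex.Im (k / e * 'i%C).
pose N : R := 1 + `|m| + `|n| / complex.Im y0.
have N0 : 0 < N.
  by rewrite /N -addrA ltr_wpDr // addr_ge0 // divr_ge0 // ltW.
have mN : 0 < m + N.
  have := ler_norm (- m); rewrite normrN => h.
  have : 0 <= `|n| / complex.Im y0 by rewrite divr_ge0 // ltW.
  by rewrite /N; lra.
have nN : 0 < complex.Im y0 + n / N.
  rewrite -(pmulr_lgt0 _ N0) mulrDl divfK ?gt_eqF //.
  have := ler_norm (- n); rewrite normrN => h.
  have -> : complex.Im y0 * N = complex.Im y0 + complex.Im y0 * `|m| + `|n|.
    by rewrite /N; field; rewrite gt_eqF.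
  have : 0 <= complex.Im y0 * `|m| by rewrite mulr_ge0 // ltW.
  by move=> ?; lra.
have NC0 : (N%:C)%C != 0 by rewrite eq_complex /= eqxx andbT gt_eqF.
have i2 : 'i%C * 'i%C = -1 :> C by rewrite -expr2 sqr_i.
have := F0 (- (c / e) + N%:C%C * 'i%C) (y0 + (k / e * 'i%C) / N%:C%C).
rewrite !ImD raddfN.
have -> : complex.Im (N%:C%C * 'i%C) = N by rewrite ImM /= mulr1 mul0r addr0.
have -> : complex.Im (k / e * 'i%C / N%:C%C) = n / N.
  rewrite ImM ImV /= oppr0 mul0r mulr0 add0r; congr (_ * _).
  by rewrite expr0n addr0 expr2; field; rewrite gt_eqF.
move=> /(_ mN nN) /eqP; apply.
rewrite be; transitivity ((a + c * y0 - k) + N%:C%C / N%:C%C * k * (1 + 'i%C * 'i%C)).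
  by rewrite /k; field; rewrite NC0 e0.
by rewrite i2 /k; ring.
Qed.

(** The coefficient of [x] is [e * beta] with [beta = y + b / e], so subtracting [e] amounts to
    replacing [x] by [x - beta^-1]. By [biaffine_pole], [beta] lies in the upper half-plane, hence
    so does the shifted point. *)
Lemma biaffine_edge a b c e :
  (forall x y, 0 < complex.Im x -> 0 < complex.Im y ->
    a + b * x + c * y + e * x * y != 0) ->
  forall x y, 0 < complex.Im x -> 0 < complex.Im y ->
    a + b * x + c * y + e * x * y - e != 0.
Proof.
move=> F0 x y Ix Iy; have [e0|e0] := eqVneq e 0.
  by have := F0 x y Ix Iy; rewrite e0 subr0.
have Ib := biaffine_pole F0 e0.
pose beta := y - (- b / e).
have Ibeta : 0 < complex.Im beta by rewrite raddfB /=; lra.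
have beta0 : beta != 0 by apply/eqP => h; move: Ibeta; rewrite h ltxx.
have := F0 (x - beta^-1) y; rewrite raddfD /= addr_gt0 ?ImN_inv_gt0 // => /(_ isT Iy).
congr (_ != 0).
have -> : b = e * beta - e * y by rewrite /beta; field.
by field.
Qed.

(** * Laguerre's theorem on polar derivatives *)

Lemma sumsqr_le0 (p q : R) : p ^+ 2 + q ^+ 2 <= 0 -> p = 0 /\ q = 0.
Proof.
move=> h; have p0 := sqr_ge0 p; have q0 := sqr_ge0 q.
by split; apply/eqP; rewrite -sqrf_eq0; apply/eqP; lra.
Qed.

(** Inversion sends each [y - z] into the disc [Im y * |A|^2 <= - Im A]. By convexity a sum of n
    points of this disc lies in its dilation by n, which is the stated bound. *)
Lemma sum_inv_halfdisc (s : seq C) y : 0 < complex.Im y ->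
  {in s, forall z, complex.Im z <= 0} ->
  complex.Im y * (complex.Re (\sum_(z <- s) (y - z)^-1) ^+ 2 +
                  complex.Im (\sum_(z <- s) (y - z)^-1) ^+ 2)
  <= - (size s)%:R * complex.Im (\sum_(z <- s) (y - z)^-1).
Proof.
move=> Iy; elim: s => [|z s IH] sI.
  by rewrite big_nil /= oppr0 mul0r !expr0n addr0 mulr0.
rewrite big_cons /=; set A := \sum_(_ <- s) _ in IH *.
have {}IH := IH (fun w ws => sI w (@mem_behead _ (z :: s) w ws)).
have Iz : complex.Im z <= 0 by apply: sI; rewrite mem_head.
have : complex.Im y * (complex.Re (y - z)^-1 ^+ 2 + complex.Im (y - z)^-1 ^+ 2)
   <= - complex.Im (y - z)^-1.
  case: (y) (z) Iy Iz => [y1 y2] [z1 z2] /= Iy Iz.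
  set p := y1 - z1; set q := y2 - z2.
  have q0 : 0 < q by rewrite /q; lra.
  have pq0 : 0 < p ^+ 2 + q ^+ 2 by rewrite ltr_wpDl ?sqr_ge0 ?exprn_gt0.
  have -> : (p / (p ^+ 2 + q ^+ 2)) ^+ 2 + (- (q / (p ^+ 2 + q ^+ 2))) ^+ 2 =
     (p ^+ 2 + q ^+ 2)^-1 by field; rewrite gt_eqF.
  by rewrite opprK ler_pM2r ?invr_gt0 // /q; lra.
move: (y - z)^-1 => B.
rewrite !raddfD /=.
move: IH; move: (complex.Re A) (complex.Im A) (complex.Re B) (complex.Im B).
move: (complex.Im y) Iy => h Iy p q s0 t IH HB.
have [s0n|n0] := posnP (size s).
  move: IH; rewrite s0n oppr0 mul0r => IH.
  have pq : p ^+ 2 + q ^+ 2 <= 0.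
    by rewrite -(pmulr_rle0 _ Iy).
  by have [-> ->] := sumsqr_le0 pq; rewrite !addr0 mulN1r.
have n0' : 0 < (size s)%:R :> R by rewrite ltr0n.
rewrite -natr1; move: ((size s)%:R) n0' IH => n n0' IH.
rewrite -(ler_pM2l n0').
have H1 : (n + 1) * (h * (p ^+ 2 + q ^+ 2)) <= (n + 1) * (- n * q).
  by rewrite ler_pM2l //; lra.
have H2 : (n + 1) * n * (h * (s0 ^+ 2 + t ^+ 2)) <= (n + 1) * n * (- t).
  by rewrite ler_pM2l // mulr_gt0 //; lra.
(* Convexity, through the identity [n |A + B|^2 = (n + 1) |A|^2 + n (n + 1) |B|^2 - |A - n B|^2]. *)
have H3 : 0 <= h * ((p - n * s0) ^+ 2 + (q - n * t) ^+ 2).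
  by rewrite mulr_ge0 ?(ltW Iy) // addr_ge0 ?sqr_ge0.
by lra.
Qed.

Lemma deriv_prod_XsubC (s : seq C) y : {in s, forall z, y - z != 0} ->
  (\prod_(z <- s) ('X - z%:P))^`().[y] =
  (\prod_(z <- s) ('X - z%:P)).[y] * \sum_(z <- s) (y - z)^-1.
Proof.
elim: s => [|z s IH] sy; first by rewrite !big_nil derivC horner0 mulr0.
rewrite !big_cons derivM derivXsubC mul1r hornerD !hornerM IH ?hornerXsubC; last first.
  by move=> w ws; apply: sy; rewrite inE ws orbT.
by field; rewrite sy ?mem_head.
Qed.

(* Laguerre's theorem for the upper half-plane. *)
Lemma polar_derivative (p : {poly C}) m y z :
  (size p <= m.+1)%N -> (0 < m)%N ->
  (forall w, 0 < complex.Im w -> p.[w] != 0) ->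
  0 < complex.Im y -> 0 < complex.Im z ->
  m%:R * p.[y] + (z - y) * p^`().[y] != 0.
Proof.
move=> pm m0 p0 Iy Iz.
have [s ps] := closed_field_poly_normal p.
have pN0 : p != 0 by apply/eqP => h; have := p0 _ Iy; rewrite h horner0 eqxx.
have ssz : (size s <= m)%N.
  by rewrite -ltnS; apply: leq_trans pm; rewrite ps size_scale ?lead_coef_eq0 // size_prod_XsubC.
have sI : {in s, forall w, complex.Im w <= 0}.
  move=> w ws; rewrite leNgt; apply/negP => /p0 /negP; apply.
  by rewrite -rootE ps rootZ ?lead_coef_eq0 // root_prod_XsubC.
have yz0 : {in s, forall w, y - w != 0}.
  move=> w /sI Iw; apply/eqP => /eqP; rewrite subr_eq0 => /eqP h.
  by move: Iw; rewrite -h leNgt Iy.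
have dp : p^`().[y] = p.[y] * \sum_(w <- s) (y - w)^-1.
  by rewrite {1 2}ps derivZ !hornerZ deriv_prod_XsubC // mulrA.
have hs := sum_inv_halfdisc Iy sI.
rewrite dp; move: (\sum_(w <- s) _) hs => A hA.
rewrite mulrCA [_ * p.[y]]mulrC -mulrDr mulf_neq0 ?p0 //; apply/negP => /eqP h.
(* The degree of [p] may be smaller than [m]. As [Im A <= 0], the bound with [size s] implies the
   one with [m]. *)
have hm : complex.Im y * (complex.Re A ^+ 2 + complex.Im A ^+ 2) <= - m%:R * complex.Im A.
  apply: (le_trans hA); rewrite !mulNr -!mulrN ler_wpM2r ?ler_nat //.
  rewrite oppr_ge0 leNgt; apply/negP => IA; move: hA; apply/negP; rewrite -ltNge.
  apply: (@le_lt_trans _ _ 0).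
    by rewrite mulNr oppr_le0 mulr_ge0 // ltW.
  by rewrite mulr_gt0 // ltr_wpDl ?sqr_ge0 // exprn_gt0.
have m0' : 0 < m%:R :> R by rewrite ltr0n.
have mC : m%:R = (m%:R : R)%:C%C by rewrite rmorph_nat.
move: h hm; rewrite mC; move: (m%:R : R) m0' => n n0 h hm.
have {}h : (y - z) * A = n%:C%C by rewrite -[RHS]subr0 -h; ring.
move: h Iy Iz hm; case: A y z {hA p0 yz0 sI ps dp} => [p1 q1] [y1 y2] [z1 z2] /=.
case=> h1 h2 Iy Iz hm.
(* The imaginary part of [(y - z) |A|^2 = n conj(A)]. Compared with [hm] it gives
   [Im z * |A|^2 <= 0], so [A = 0], which contradicts [(y - z) A = n]. *)
have h3 : (y2 - z2) * (p1 ^+ 2 + q1 ^+ 2) = - n * q1.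
  have -> : n = (y1 - z1) * p1 - (y2 - z2) * q1 by rewrite -h1.
  have e : (y1 - z1) * q1 = - ((y2 - z2) * p1) by apply/eqP; rewrite -addr_eq0 h2.
  transitivity ((y2 - z2) * (p1 ^+ 2 + q1 ^+ 2)); first by [].
  transitivity (- p1 * ((y1 - z1) * q1) + (y2 - z2) * q1 ^+ 2); last by ring.
  by rewrite e; ring.
have pq : p1 ^+ 2 + q1 ^+ 2 <= 0.
  by rewrite -(pmulr_rle0 _ Iz); move: hm; rewrite -h3; lra.
have [p10 q10] := sumsqr_le0 pq.
by move: n0; rewrite -h1 p10 q10 !mulr0 subrr ltxx.
Qed.

(** * Stable multiaffine functions and symmetrization *)

Definition stable (W : finType) (P : (W -> C) -> C) :=
  forall x, (forall w, 0 < complex.Im (x w)) -> P x != 0.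

(** With the other variables frozen, [P] is biaffine in those at [u] and [v], and the coefficient of
    their product is the mixed derivative, so [biaffine_edge] applies. *)
Lemma stable_edge_op (W : finType) (u v : W) P : u != v ->
  multiaffine P -> stable P -> stable (edge_op u v P).
Proof.
move=> uv affP stP x Ix.
pose Q s t := P (upd (upd x u s) v t).
have QE s t : Q s t = Q 0 0 + (Q 1 0 - Q 0 0) * s + (Q 0 1 - Q 0 0) * t +
    (Q 1 1 - Q 1 0 - Q 0 1 + Q 0 0) * s * t.
  rewrite /Q (affP v (upd x u s) t) /dif !(updC _ _ _ uv).
  by rewrite (affP u (upd x v 1) s) (affP u (upd x v 0) s) /dif; ring.
have Q0 s t : 0 < complex.Im s -> 0 < complex.Im t -> Q s t != 0.
  move=> Is It; apply: stP => w; rewrite /upd.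
  by case: eqP => // _; case: eqP.
have -> : edge_op u v P x = Q (x u) (x v) - (Q 1 1 - Q 1 0 - Q 0 1 + Q 0 0).
  rewrite /Q upd_id upd_id /edge_op /dif; congr (_ - _); ring.
rewrite QE; apply: biaffine_edge => // s t Is It.
by rewrite -QE; apply: Q0.
Qed.

Lemma stable_edge_ops (W : finType) (es : seq (W * W)) P :
  all (fun f => f.1 != f.2) es ->
  multiaffine P -> stable P -> stable (edge_ops es P).
Proof.
move=> + affP stP; elim: es => //= e es IH /andP[e12 /IH {}IH].
by apply: stable_edge_op => //; apply: multiaffine_edge_ops.
Qed.

Definition fill (W : finType) (s : seq W) (y : C) (x : W -> C) : W -> C :=
  fun w => if w \in s then y else x w.

(** The polynomial is built by splitting off one variable at a time as [p0 + 'X * p1], with [p0]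
    from the value at 0 and [p1] from the partial derivative. The formula for the derivative is the
    chain rule on the diagonal. *)
Lemma multiaffine_diag (W : finType) (P : (W -> C) -> C) (s : seq W) x :
  multiaffine P -> uniq s ->
  exists p : {poly C}, [/\ (size p <= (size s).+1)%N,
    forall y, p.[y] = P (fill s y x) &
    forall y, p^`().[y] = \sum_(w <- s) dif w P (fill s y x)].
Proof.
elim: s x P => [|a s IH] x P affP /=.
  exists (P x)%:P; split=> [|y|y].
  - by rewrite size_polyC; case: eqP.
  - by rewrite hornerC.
  - by rewrite derivC horner0 big_nil.
case/andP=> as_ us.
have [p0 [sp0 p0E dp0E]] := IH (upd x a 0) P affP us.
have [p1 [sp1 p1E dp1E]] := IH x _ (multiaffine_dif a affP) us.
have fillE y : fill (a :: s) y x = upd (fill s y x) a y.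
  by apply/funext => w; rewrite /fill /upd inE; case: eqP.
have fill0 y : fill s y (upd x a 0) = upd (fill s y x) a 0.
  apply/funext => w; rewrite /fill /upd; case: eqP => [->|//].
  by rewrite (negPf as_).
exists (p0 + 'X * p1); split=> [|y|y].
- apply: leq_trans (size_polyD _ _) _; rewrite geq_max (leq_trans sp0) //=.
  apply: leq_trans (size_polyMleq _ _) _.
  by rewrite size_polyX /= ltnS.
- by rewrite hornerD hornerM hornerX p0E p1E fill0 fillE -affP.
- rewrite derivD derivM derivX mul1r !hornerD hornerM hornerX p1E dp0E dp1E.
  rewrite big_cons fillE dif_upd addrCA; congr (_ + _).
  rewrite mulr_sumr -big_split /=; apply: eq_bigr => w _.
  by rewrite fill0 difC -multiaffine_dif.
Qed.

(* Grace-Walsh-Szego: the coordinates of [s] are freed one by one, each time by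
   a polar derivative of the restriction of [P] to the diagonal of the others. *)
Lemma stable_symmetric (W : finType) (P : (W -> C) -> C) (s : seq W) :
  multiaffine P -> uniq s ->
  (forall u v x, u \in s -> v \in s -> P (x \o tperm u v) = P x) ->
  (forall x y, (forall w, 0 < complex.Im (x w)) ->
     0 < complex.Im y -> P (fill s y x) != 0) ->
  stable P.
Proof.
move=> affP; elim: s => [|a s IH] us symP P0 x Ix.
  have -> : x = fill [::] 'i%C x by [].
  by apply: P0 => //; apply: ltr01.
case/andP: (us) => as_ us'.
apply: IH x Ix => //.
  by move=> b c x bs cs; apply: symP; rewrite inE ?bs ?cs orbT.
move=> {}x y Ix Iy.
have [p [sp pE dpE]] := multiaffine_diag x affP us.
have p0 w : 0 < complex.Im w -> p.[w] != 0 by rewrite pE; apply: P0.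
(* By symmetry all the partial derivatives agree at the diagonal point [z]. The polar derivative
   towards [x a] is therefore [size (a :: s)] times [P z + (x a - y) * dif a P z], which is [P] with
   the coordinate [a] moved back to [x a]. *)
have := @polar_derivative p _ y (x a) sp isT p0 Iy (Ix a).
rewrite pE dpE.
set z := fill (a :: s) y x.
have zE : z = upd (fill s y x) a y.
  by apply/funext => w; rewrite /z /fill /upd inE; case: eqP.
have -> : \sum_(w <- a :: s) dif w P z = (size (a :: s))%:R * dif a P z.
  rewrite -sum1_size natr_sum mulr_suml; apply: eq_big_seq => w ws; rewrite mul1r.
  have ztp t : upd z w t = upd z a t \o tperm a w.
    apply/funext => b; rewrite /upd /=.
    case: tpermP => [->|->|/eqP ba /eqP bw].
    - by rewrite eq_sym; case: eqVneq => // aw; rewrite /z /fill ws mem_head.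
    - by rewrite !eqxx.
    - by rewrite (negPf ba) (negPf bw).
  by rewrite /dif !ztp !symP ?mem_head.
have -> : P (fill s y x) = P z + (x a - y) * dif a P z.
  rewrite zE dif_upd [in RHS]affP.
  have {1}-> : fill s y x = upd (fill s y x) a (x a).
    by rewrite -[in LHS](upd_id (fill s y x) a) {2}/fill (negPf as_).
  by rewrite affP; ring.
by rewrite mulrCA -mulrDr mulf_eq0 negb_or => /andP[].
Qed.
End Stability.

(** * Matching polynomials of coverings *)

Section WeightedMatchings.
Variables (W : finType) (K : comNzRingType).
Implicit Types (x : W -> K) (es : seq (W * W)) (S : {set W}).

(* The sum over the matchings M of [es] inside S of (-1)^|M| times the product
   of x over the vertices of S not covered by M. *)
Fixpoint mu x es S : K :=
  if es is e :: es' then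
    mu x es' S - (if (e.1 \in S) && (e.2 \in S) then mu x es' (S :\ e.1 :\ e.2) else 0)
  else \prod_(w in S) x w.

Lemma mu_upd_notin x es S w t : w \notin S -> mu (upd x w t) es S = mu x es S.
Proof.
elim: es S => [|e es IH] S wS /=.
  by apply: eq_bigr => v vS; rewrite /upd; case: eqP vS wS => // -> ->.
rewrite IH //; congr (_ - _); case: ifP => // _; apply: IH.
by rewrite !inE negb_and negb_and wS !orbT.
Qed.

(** A matching either covers [w], and its term does not involve [t], or leaves [w] uncovered, and
    its term has the factor [t]. *)
Lemma mu_upd x es S w t : w \in S ->
  mu (upd x w t) es S = mu (upd x w 0) es S + t * mu x es (S :\ w).
Proof.
elim: es S => [|e es IH] S wS /=.
  rewrite !(bigD1 w wS) /= {1 3}/upd eqxx mul0r add0r; congr (_ * _).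
  apply: eq_big => [v|v /andP[_ /negPf vw]]; first by rewrite in_setD1 andbC.
  by rewrite /upd vw.
suff H : (if (e.1 \in S) && (e.2 \in S) then mu (upd x w t) es (S :\ e.1 :\ e.2) else 0) =
  (if (e.1 \in S) && (e.2 \in S) then mu (upd x w 0) es (S :\ e.1 :\ e.2) else 0) +
  t * (if (e.1 \in S :\ w) && (e.2 \in S :\ w)
       then mu x es (S :\ w :\ e.1 :\ e.2) else 0).
  by rewrite IH // H; ring.
rewrite !in_setD1.
have [ew1|ew1] := eqVneq e.1 w => /=.
  by case: ifP; rewrite mulr0 addr0 ?mu_upd_notin // ew1 !inE eqxx ?andbF.
have [ew2|ew2] := eqVneq e.2 w => /=.
  rewrite andbF mulr0 addr0; case: ifP => _ //.
  by rewrite !mu_upd_notin // ew2 !inE eqxx.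
case: ifP => // _; last by rewrite mulr0 addr0.
have wS' : w \in S :\ e.1 :\ e.2 by rewrite !inE ![w == _]eq_sym ew1 ew2.
rewrite IH //; congr (_ + _ * mu _ _ _).
by apply/setP => v; rewrite !inE; do !case: (_ == _).
Qed.

Lemma multiaffine_mu es S : multiaffine (fun x => mu x es S).
Proof.
move=> w x t; rewrite /dif; have [wS|wS] := boolP (w \in S).
  by rewrite (mu_upd _ _ t wS) (mu_upd _ _ 1 wS) mul1r [_ + _ - _]addrAC subrr add0r.
by rewrite !mu_upd_notin // subrr mulr0 addr0.
Qed.

Lemma dif_mu es S w : w \in S ->
  dif w (fun x => mu x es S) = fun x => mu x es (S :\ w).
Proof. by move=> wS; apply/funext => x; rewrite /dif mu_upd //; ring. Qed.

(** Differentiating in a variable deletes its vertex, so for an edge with distinct endpoints the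
    recursion of [mu] is exactly [edge_op]. *)
Lemma mu_cat x es1 es2 : all (fun e => e.1 != e.2) es1 ->
  mu x (es1 ++ es2) [set: W]%SET = edge_ops es1 (fun x => mu x es2 [set: W]%SET) x.
Proof.
elim: es1 x => //= e es1 IH x /andP[e12 /IH {}IH]; rewrite /edge_op -IH !inE /=.
congr (_ - _); rewrite -(_ : (fun x => mu x (es1 ++ es2) [set: W]%SET) = edge_ops _ _).
  by rewrite difC dif_mu ?inE // dif_mu // !inE eq_sym e12.
by apply/funext => y; apply: IH.
Qed.

Lemma mu_swap x e f es S : mu x [:: e, f & es] S = mu x [:: f, e & es] S.
Proof.
rewrite /= -!addrA; congr (_ + _).
have -> : S :\ e.1 :\ e.2 :\ f.1 :\ f.2 = S :\ f.1 :\ f.2 :\ e.1 :\ e.2.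
  by apply/setP => v; rewrite !inE; do !case: (_ == _).
pose D := [&& f.1 != e.1, f.1 != e.2, f.2 != e.1 & f.2 != e.2].
have -> : (f.1 \in S :\ e.1 :\ e.2) && (f.2 \in S :\ e.1 :\ e.2) =
    D && ((f.1 \in S) && (f.2 \in S)).
  by rewrite !inE /D; do !case: (_ == _) => //=; rewrite ?andbF.
have -> : (e.1 \in S :\ f.1 :\ f.2) && (e.2 \in S :\ f.1 :\ f.2) =
    D && ((e.1 \in S) && (e.2 \in S)).
  by rewrite !inE ![e.1 == _]eq_sym ![e.2 == _]eq_sym /D; do !case: (_ == _) => //=; rewrite ?andbF.
by case: (_ && _); case: (_ && _); case: D => /=; ring.
Qed.

Lemma mu_perm x es1 es2 S : perm_eq es1 es2 -> mu x es1 S = mu x es2 S.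
Proof.
have front e p q T : mu x (p ++ e :: q) T = mu x (e :: p ++ q) T.
  elim: p T => // f p IH T.
  by rewrite -[RHS]mu_swap /= !IH.
elim: es1 es2 S => [|e es1 IH] es2 S; first by rewrite perm_sym => /perm_nilP ->.
move=> pe; have : e \in es2 by rewrite -(perm_mem pe) mem_head.
move=> /path.splitPr spe; case: spe pe => p q pe.
rewrite front; move: pe; rewrite perm_sym perm_catC /= perm_cons perm_catC perm_sym => pe.
by rewrite /= !(IH _ _ pe).
Qed.

Lemma mu_rename (g : W -> W) x es : injective g ->
  mu (x \o g) es [set: W]%SET = mu x [seq (g e.1, g e.2) | e <- es] [set: W]%SET.
Proof.
move=> gI.
suff H S : mu (x \o g) es S = mu x [seq (g e.1, g e.2) | e <- es] (g @: S).
  rewrite H; congr mu; apply/setP => v; rewrite inE.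
  by have [g' gK g'K] := injF_bij gI; rewrite -(g'K v) imset_f.
elim: es S => [|e es IH] S /=; first by rewrite big_imset //; apply: in2W.
rewrite IH !mem_imset // IH; congr (_ - _); case: ifP => // _; congr mu.
apply/setP => v; have [g' gK g'K] := injF_bij gI.
by rewrite -(g'K v) !inE !mem_imset // !inE !(inj_eq gI).
Qed.

(** Expansion at a vertex: [v] is uncovered or is matched along one edge. The two summands for each
    edge correspond to which of its ends is [v]. *)
Lemma mu_vertex x es S v : all (fun e => e.1 != e.2) es -> v \in S ->
  mu x es S = x v * mu x es (S :\ v)
   - \sum_(e <- es) ((if (e.1 == v) && (e.2 \in S :\ v) then mu x es (S :\ v :\ e.2) else 0)
                   + (if (e.2 == v) && (e.1 \in S :\ v) then mu x es (S :\ v :\ e.1) else 0)).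
Proof.
move=> + vS; elim: es S vS => [|e es IH] S vS.
  by rewrite big_nil subr0 /= (big_setD1 v).
case/andP=> e12 /IH {}IH.
have vS' : v \notin S :\ v by rewrite !inE eqxx.
have mu1 (T : {set W}) : (e.1 == v) || (e.2 == v) -> v \notin T -> mu x (e :: es) T = mu x es T.
  by case/orP => /eqP ev vT /=; rewrite ev (negPf vT) ?andbF subr0.
have vT u : v \notin S :\ v :\ u by rewrite !inE eqxx andbF.
rewrite big_cons.
have [ev|ev] := eqVneq e.1 v.
  have ev2 : e.2 != v by rewrite -ev eq_sym.
  have e1v : (e.1 == v) || (e.2 == v) by rewrite ev eqxx.
  under eq_bigr do rewrite !(mu1 _ e1v (vT _)).
  rewrite !(mu1 _ e1v (vT _)) (mu1 _ e1v vS').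
  rewrite /= ev vS IH // (negPf ev2) /= addr0 in_setD1 ev2 /=.
  by case: ifP => _; ring.
have [ev2|ev2] := eqVneq e.2 v.
  have e1v : (e.1 == v) || (e.2 == v) by rewrite ev2 eqxx orbT.
  under eq_bigr do rewrite !(mu1 _ e1v (vT _)).
  rewrite !(mu1 _ e1v (vT _)) (mu1 _ e1v vS').
  rewrite /= ev2 vS IH // /= add0r in_setD1 ev /= andbT.
  rewrite (_ : S :\ e.1 :\ v = S :\ v :\ e.1); last first.
    by apply/setP => u; rewrite !inE andbCA.
  by case: ifP => _; ring.
rewrite add0r /= !in_setD1 ev ev2 /=.
case: ifP => eS; last first.
  rewrite (IH _ vS) !subr0 !add0r; congr (_ - _); apply: eq_bigr => f _.
  have H u : (e.1 \in S :\ v :\ u) && (e.2 \in S :\ v :\ u) = false.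
    by rewrite !inE andbCA; move: eS; do 2!case: (_ \in S) => //=; rewrite ?andbF.
  by rewrite !H !subr0.
have vS2 : v \in S :\ e.1 :\ e.2 by rewrite !inE ![v == _]eq_sym ev ev2.
rewrite (IH _ vS) (IH _ vS2).
have SE : S :\ e.1 :\ e.2 :\ v = S :\ v :\ e.1 :\ e.2.
  by apply/setP => u; rewrite !inE; do !case: (_ == _).
rewrite SE.
(* Both endpoints of [e] survive the deletion of [u] exactly when [u] survives the deletion of the
   endpoints of [e], so the two deletions commute. *)
have H c u :
  (if c && (u \in S :\ v) then mu x es (S :\ v :\ u) -
     (if (e.1 \in S :\ v :\ u) && (e.2 \in S :\ v :\ u)
      then mu x es (S :\ v :\ u :\ e.1 :\ e.2) else 0) else 0) =
  (if c && (u \in S :\ v) then mu x es (S :\ v :\ u) else 0) -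
  (if c && (u \in S :\ v :\ e.1 :\ e.2)
   then mu x es (S :\ v :\ e.1 :\ e.2 :\ u) else 0).
  have -> : S :\ v :\ u :\ e.1 :\ e.2 = S :\ v :\ e.1 :\ e.2 :\ u.
    by apply/setP => w; rewrite !inE; do !case: (_ == _).
  rewrite !inE ev ev2 /=; case/andP: eS => -> ->; rewrite !andbT.
  case: c => /=; last by rewrite subr0.
  rewrite ![u == e.1]eq_sym ![u == e.2]eq_sym.
  case: (u == v); rewrite ?andbF ?subr0 //=.
  by case: (u \in S); case: (e.1 == u); case: (e.2 == u); rewrite ?subr0 ?subrr.
rewrite add0r; under [X in _ = _ - X]eq_bigr do rewrite !H addrACA -opprD.
by rewrite sumrB; ring.
Qed.

End WeightedMatchings.

(** * The matching polynomial as a diagonal value of [mu] *)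

Section MatchingPolynomial.
Variables (H : mgraph) (K : comNzRingType).
Hypothesis H_loopless : loopless H.
Implicit Types (M : {set gedge H}) (S : {set vert H}) (x : K).

Lemma is_matchingP M :
  reflect {in M &, forall e f, e != f -> [disjoint endpoints e & endpoints f]}
          (is_matching M).
Proof.
apply: (iffP forall_inP) => [mM e f eM fM|mM e eM].
  by move/implyP: (forall_inP (mM e eM) f fM).
by apply/forall_inP => f fM; apply/implyP; apply: mM.
Qed.

(** Double counting of incidences: an edge of [M] has two endpoints, and a vertex lies on at most
    one edge of [M]. *)
Lemma matching_card_le M : is_matching M -> (2 * #|M| <= #|vert H|)%N.
Proof.
move/is_matchingP => mM.
have -> : (2 * #|M| = \sum_(e in M) \sum_(v in endpoints e) 1)%N.
  under eq_bigr do rewrite sum1_card cards2 H_loopless.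
  by rewrite sum_nat_const mulnC.
rewrite (exchange_big_dep predT) //= -sum1_card; apply: leq_sum => v _.
rewrite -big_filter_cond /= sum1_count -size_filter.
set s := [seq j <- _ | v \in endpoints j].
have sM e : e \in s -> (e \in M) && (v \in endpoints e).
  by rewrite !mem_filter => /and3P[-> -> _].
have us : uniq s by rewrite !filter_uniq ?index_enum_uniq.
case: s us sM => [|e [|f s]] //=; rewrite inE negb_or => /and3P[/andP[ef _] _ _] sM.
have /andP[eM ve] : (e \in M) && (v \in endpoints e) by apply: sM; rewrite mem_head.
have /andP[fM vf] : (f \in M) && (v \in endpoints f) by apply: sM; rewrite !inE eqxx orbT.
by have := disjointFr (mM _ _ eM fM ef) ve; rewrite vf.
Qed.

Lemma mu_matchings x (es : seq (gedge H)) S : uniq es ->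
  mu (fun=> x) [seq (etail e, ehead e) | e <- es] S =
  \sum_(M : {set gedge H} | [&& is_matching M, M \subset es &
      [forall e in M, endpoints e \subset S]])
    (-1) ^+ #|M| * x ^+ (#|S| - 2 * #|M|).
Proof.
elim: es S => [|e es IH] S /=.
  move=> _; rewrite (big_pred1 finset.set0) => [|M].
    by rewrite cards0 muln0 subn0 expr0 mul1r prodr_const.
  apply/and3P/eqP => [[_ /fintype.subsetP M0 _]|->].
    by apply/setP => f; rewrite inE; apply/negP => /M0.
  split; last by apply/forall_inP => f; rewrite inE.
    by apply/is_matchingP => f; rewrite inE.
  by apply/fintype.subsetP => f; rewrite inE.
case/andP=> ees us; rewrite !IH // [RHS](bigID (fun M => e \notin M)) /=.
congr (_ + _).
  apply: eq_bigl => M; rewrite -!andbA; congr (_ && _).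
  apply/andP/and3P => [[/fintype.subsetP Mes MS]|[/fintype.subsetP Mes MS eM]]; split => //.
  - by apply/fintype.subsetP => f /Mes; rewrite inE => ->; rewrite orbT.
  - by apply: contra ees => /Mes.
  - apply/fintype.subsetP => f fM; have := Mes f fM; rewrite inE => /orP[/eqP fe|//].
    by move: eM; rewrite -fe fM.
have sub S' : (endpoints e \subset S') = (etail e \in S') && (ehead e \in S').
  by rewrite /endpoints finset.subUset !finset.sub1set.
(* Matchings containing [e] correspond, by removing [e], to matchings inside [S] without the
   endpoints of [e]. *)
rewrite [RHS](reindex_onto (fun M => e |: M) (fun M => M :\ e)) /=; last first.
  by move=> M /andP[_]; rewrite negbK; apply: finset.setD1K.
rewrite -sub; case: ifP => eS; last first.
  rewrite oppr0 big_pred0 // => M; apply/negP => /andP[/andP[/and3P[_ _ /forall_inP h] _] _].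
  by have := h e; rewrite setU11 eS => /(_ isT).
set S' := S :\ _ :\ _.
have S'E : S' = S :\: endpoints e.
  by apply/setP => v; rewrite !inE negb_or andbA [_ && (v != etail e)]andbC.
have cS : #|S| = #|S'|.+2.
  have /andP[tS hS] : (etail e \in S) && (ehead e \in S) by rewrite -sub.
  rewrite (cardsD1 (etail e)) tS (cardsD1 (ehead e)) !inE hS eq_sym.
  by rewrite H_loopless.
rewrite -sumrN; apply: eq_big => [M|M /and3P[_ /fintype.subsetP Mes _]]; last first.
  have eM : e \notin M by apply: contra ees => /Mes.
  by rewrite cardsU1 eM add1n exprS mulN1r mulNr cS mulnS.
apply/and3P/andP => [[mM /fintype.subsetP Mes /forall_inP MS]|].
  have eM : e \notin M by apply: contra ees => /Mes.
  split; last by rewrite setU1K.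
  rewrite !inE eqxx andbT; apply/and3P; split.
  - apply/is_matchingP => f g; rewrite !inE => /orP[/eqP->|fM] /orP[/eqP->|gM].
    + by rewrite eqxx.
    + by move=> _; rewrite fintype.disjoint_sym; have := MS g gM; rewrite S'E finset.subsetD => /andP[].
    + by move=> _; have := MS f fM; rewrite S'E finset.subsetD => /andP[].
    + by apply: (is_matchingP _ mM).
  - by apply/fintype.subsetP => f; rewrite !inE => /orP[->//|/Mes->]; rewrite orbT.
  - apply/forall_inP => f; rewrite !inE => /orP[/eqP->//|/MS].
    by rewrite S'E finset.subsetD => /andP[].
case=> /andP[/and3P[/is_matchingP mM /fintype.subsetP Mes /forall_inP MS] _] /eqP eM'.
have eM : e \notin M by rewrite -eM' !inE eqxx.
split.
- by apply/is_matchingP => f g fM gM; apply: mM; rewrite inE ?fM ?gM orbT.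
- apply/fintype.subsetP => f fM; have := Mes f; rewrite !inE fM orbT => /(_ isT).
  by case/orP => // /eqP fe; move: eM; rewrite -fe fM.
- apply/forall_inP => f fM; rewrite S'E finset.subsetD MS ?inE ?fM ?orbT //=.
  apply: mM; rewrite ?inE ?fM ?eqxx ?orbT //.
  by apply/eqP => fe; move: eM; rewrite -fe fM.
Qed.

Lemma matching_poly_mu x (es : seq (gedge H)) : uniq es -> (forall e, e \in es) ->
  (matching_poly K H).[x] =
  mu (fun=> x) [seq (etail e, ehead e) | e <- es] [set: vert H]%SET.
Proof.
move=> us eses; rewrite mu_matchings // cardsT.
(* [inord] would send an out-of-range size to a default; [matching_card_le] excludes this for
   matchings. *)
pose idx M : 'I_(#|vert H|./2).+1 := inord #|M|.
rewrite (eq_bigl (@is_matching H)) => [|M]; last first.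
  apply/and3P/idP => [[]//|mM]; split => //; first exact/fintype.subsetP.
  by apply/forall_inP => e _; apply: finset.subsetT.
rewrite (partition_big idx predT) //= /matching_poly horner_sum.
apply: eq_bigr => i _; rewrite hornerZ hornerXn /nmatchings -sum1_card natr_sum.
rewrite mulr_sumr mulr_suml; apply: eq_big => [M|M].
  rewrite inE; have [mM|//] := boolP (is_matching M) => /=.
  by rewrite /idx -val_eqE /= inordK // ltnS geq_half_double -mul2n matching_card_le.
by rewrite inE => /andP[mM /eqP->]; rewrite mulr1.
Qed.

End MatchingPolynomial.

(** Exchanging [s] with the value of [tau] at [e] is an involution on pairs. This is what separates
    the permutation of one edge from all the others in the average. *)
Lemma sum_ffun_upd (E T : finType) (Z : zmodType) (e : E)
    (F : T -> {ffun E -> T} -> Z) :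
  \sum_s \sum_(tau : {ffun E -> T}) F s [ffun f => if f == e then s else tau f] =
  (\sum_(tau : {ffun E -> T}) F (tau e) tau) *+ #|T|.
Proof.
pose h (p : {ffun E -> T} * T) :=
  ([ffun f => if f == e then p.2 else p.1 f], p.1 e).
have hK : involutive h.
  move=> [tau s]; rewrite /h /= ffunE eqxx; congr (_, _).
  by apply/ffunP => f; rewrite !ffunE; case: eqP => [->|].
rewrite exchange_big pair_big /=.
transitivity (\sum_p (fun q : {ffun E -> T} * T => F (q.1 e) q.1) (h p)).
  by apply: eq_bigr => p _; rewrite /= ffunE eqxx.
rewrite -(reindex_inj (P := xpredT) (F := fun q : {ffun E -> T} * T => F (q.1 e) q.1) (inv_inj hK)).
rewrite -(pair_big xpredT xpredT (fun (tau : {ffun E -> T}) (_ : T) => F (tau e) tau)) /= -sumrMnl.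
by apply: eq_bigr => tau _; rewrite sumr_const.
Qed.

Lemma perm_map_enum (T : finType) (s : {perm T}) :
  perm_eq [seq s i | i <- enum T] (enum T).
Proof.
apply: uniq_perm; rewrite ?(map_inj_uniq (@perm_inj _ s)) ?enum_uniq // => i.
by rewrite mem_enum -(permKV s i) map_f ?mem_enum.
Qed.

(** * Averages over coverings and their stability *)

Section Coverings.
Variables (G : mgraph) (d : nat).
Hypothesis G_loopless : loopless G.
Local Notation W := (vert G * 'I_d)%type.

(** One permutation is kept per unoriented edge, and the list [L] is a parameter so that the edges
    of [G] can be inserted one at a time. *)
Definition cedges (tau : {ffun gedge G -> 'S_d}) (L : seq (gedge G)) : seq (W * W) :=
  [seq ((etail e, i), (ehead e, tau e i)) | e <- L, i <- enum 'I_d].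

Lemma covering_horner (K : comNzRingType) (s : {ffun dart G -> 'S_d}) (x : K) :
  (matching_poly K (covering_graph s)).[x] =
  mu (fun=> x) (cedges [ffun e => s (e, true)] (enum (gedge G))) [set: W]%SET.
Proof.
pose es : seq (gedge (covering_graph s)) := [seq (e, i) | e <- enum (gedge G), i <- enum 'I_d].
rewrite (@matching_poly_mu _ _ _ _ es).
- congr mu; rewrite /es /cedges map_allpairs; apply: eq_allpairs => e i.
  by rewrite /= ffunE.
- by move=> e; rewrite xpair_eqE negb_and G_loopless.
- by apply: allpairs_uniq => [||[? ?] [? ?] _ _ []]; rewrite ?enum_uniq // => -> ->.
- by case=> e i; apply: allpairs_f; rewrite mem_enum.
Qed.

Lemma sum_coverings (Z : zmodType) (F : {ffun gedge G -> 'S_d} -> Z) :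
  \sum_(s in coverings d G) F [ffun e => s (e, true)] = \sum_tau F tau.
Proof.
pose h (tau : {ffun gedge G -> 'S_d}) : {ffun dart G -> 'S_d} :=
  [ffun a => if a.2 then tau a.1 else (tau a.1)^-1]%g.
rewrite (reindex_onto h (fun s => [ffun e => s (e, true)])) /=; last first.
  move=> s; rewrite inE => /forallP sP; apply/ffunP => -[e b]; rewrite !ffunE /=.
  by case: b => //; rewrite -(eqP (sP (e, true))).
apply: eq_big => [tau|tau /andP[_ /eqP->] //].
rewrite inE; apply/andP; split.
  apply/forallP => -[e b]; rewrite !ffunE /=.
  by case: b; rewrite /= ?invgK.
by apply/eqP/ffunP => e; rewrite !ffunE.
Qed.

Lemma card_coverings_gt0 : (0 < #|coverings d G|)%N.
Proof.
by apply/card_gt0P; exists [ffun=> 1%g]; rewrite inE; apply/forallP => a; rewrite !ffunE invg1.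
Qed.

(** An unnormalised average: [tau] also varies at the edges outside [L], which only multiplies the
    sum by a constant. *)
Definition avg_mu (K : comNzRingType) L (x : W -> K) :=
  \sum_tau mu x (cedges tau L) [set: W]%SET.

Lemma cedges_cons tau e L : cedges tau (e :: L) =
  [seq ((etail e, i), (ehead e, tau e i)) | i <- enum 'I_d] ++ cedges tau L.
Proof. by rewrite /cedges allpairs_cons. Qed.

Lemma eq_cedges (tau tau' : {ffun gedge G -> 'S_d}) (L : seq (gedge G)) :
  {in L, tau =1 tau'} -> cedges tau L = cedges tau' L.
Proof. by move=> tt; apply/eq_in_allpairs => e i eL _; rewrite tt. Qed.

Lemma multiaffine_avg_mu (K : comNzRingType) L : multiaffine (@avg_mu K L).
Proof. by apply: multiaffine_sum => tau; apply: multiaffine_mu. Qed.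

Definition fibre_perm (pi : vert G -> 'S_d) (w : W) : W := (w.1, pi w.1 w.2).

Lemma fibre_perm_inj pi : injective (fibre_perm pi).
Proof. by move=> [u i] [v j] [-> /perm_inj->]. Qed.

(** Relabelling the fibres by [pi] carries the covering of [tau] to that of [h tau], and [h]
    permutes the assignments. *)
Lemma avg_mu_fibre_perm (K : comNzRingType) L pi (x : W -> K) :
  avg_mu L (x \o fibre_perm pi) = avg_mu L x.
Proof.
pose h (tau : {ffun gedge G -> 'S_d}) :=
  [ffun e => (pi (etail e))^-1 * tau e * pi (ehead e)]%g.
have hI : injective h.
  move=> s t /ffunP st; apply/ffunP => e; move: (st e); rewrite !ffunE.
  by move/mulIg/mulgI.
rewrite /avg_mu [RHS](reindex_inj hI); apply: eq_bigr => tau _.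
rewrite mu_rename; last exact: fibre_perm_inj.
apply: mu_perm; elim: L => // e L IH; rewrite !cedges_cons map_cat.
apply: perm_cat => //; rewrite -map_comp.
pose f i : W * W := ((etail e, i), (ehead e, h tau e i)).
rewrite -(eq_map (_ : f \o pi (etail e) =1 _)) => [|i] /=.
  by rewrite map_comp; apply/perm_map/perm_map_enum.
by rewrite /f /fibre_perm /= ffunE !permM permK.
Qed.

Lemma avg_mu_cons (K : comNzRingType) e L (x : W -> K) : e \notin L ->
  avg_mu (e :: L) x *+ #|{: 'S_d}| =
  \sum_(s : 'S_d) edge_ops [seq ((etail e, i), (ehead e, s i)) | i <- enum 'I_d]
                     (avg_mu L) x.
Proof.
move=> eL; rewrite /avg_mu.
under [RHS]eq_bigr do rewrite edge_ops_sum.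
have := sum_ffun_upd e (fun (s : 'S_d) tau => mu x
  ([seq ((etail e, i), (ehead e, s i)) | i <- enum 'I_d] ++ cedges tau L) [set: W]%SET).
under [X in _ = X *+ _]eq_bigr do rewrite -cedges_cons.
move=> <-.
apply: eq_bigr => s _; apply: eq_bigr => tau _; rewrite mu_cat.
  rewrite (@eq_cedges _ tau) // => f fL; rewrite ffunE; case: eqP => // fe.
  by move: eL; rewrite -fe fL.
by apply/allP => f /mapP[i _ ->]; rewrite xpair_eqE negb_and G_loopless.
Qed.

Lemma stable_avg_mu (R : rcfType) L : uniq L -> stable (@avg_mu R[i] L).
Proof.
elim: L => [|e L IH] /=.
  move=> _ x Ix; rewrite /avg_mu sumr_const /= mulrn_eq0 negb_or -lt0n.
  rewrite (_ : 0 < #|_|)%N; last by apply/card_gt0P; exists [ffun=> 1%g].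
  apply/prodf_neq0 => w _; apply/eqP => xw; move: (Ix w); rewrite xw ltxx //.
case/andP=> eL /IH {}IH.
pose es := [seq ((etail e, i), (ehead e, i)) | i <- enum 'I_d].
pose P := edge_ops es (@avg_mu R[i] L).
have esP : all (fun f => f.1 != f.2) es.
  by apply/allP => f /mapP[i _ ->]; apply/eqP => -[]; apply/eqP; apply: G_loopless.
have affP : multiaffine P by apply/multiaffine_edge_ops/multiaffine_avg_mu.
have stP : stable P by apply: stable_edge_ops => //; apply: multiaffine_avg_mu.
pose pi (s : 'S_d) (v : vert G) : 'S_d := if v == ehead e then s else 1%g.
(* [Q] symmetrizes [P] over the fibre of the head of [e]. Since [avg_mu L] is invariant under fibre
   permutations, only the inserted edges feel the relabelling, and they become those of the
   permutation [s]. *)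
pose Q x := \sum_(s : 'S_d) P (x \o fibre_perm (pi s)).
have QE x : avg_mu (e :: L) x *+ #|{: 'S_d}| = Q x.
  rewrite avg_mu_cons //; apply: eq_bigr => s _.
  rewrite /P [RHS]edge_ops_rename; last exact: fibre_perm_inj.
  rewrite (_ : (fun y => avg_mu L (y \o _)) = avg_mu L); last first.
    by apply/funext => y; rewrite avg_mu_fibre_perm.
  have -> : [seq (fibre_perm (pi s) f.1, fibre_perm (pi s) f.2) | f <- es] =
      [seq ((etail e, i), (ehead e, s i)) | i <- enum 'I_d]; last by [].
  rewrite -map_comp; apply: eq_map => i /=.
  by rewrite /fibre_perm /pi /= eqxx (negPf (G_loopless e)) perm1.
suff stQ : stable Q.
  by move=> x /stQ; rewrite -QE mulrn_eq0 negb_or => /andP[].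
apply: (@stable_symmetric _ _ _ [seq (ehead e, i) | i <- enum 'I_d]).
- apply: multiaffine_sum => s; apply: multiaffine_rename => //.
  exact: fibre_perm_inj.
- by rewrite map_inj_uniq ?enum_uniq // => i j [].
- move=> _ _ x /mapP[i _ ->] /mapP[j _ ->].
  rewrite /Q (reindex_inj (mulIg (tperm i j))) /=; apply: eq_bigr => s _.
  congr P; apply/funext => -[v k] /=; congr x.
  rewrite /fibre_perm /= /pi; case: eqP => [->|/eqP vh].
    rewrite permM; have [->|ki] := eqVneq (s k) i; first by rewrite tpermL tpermR.
    have [->|kj] := eqVneq (s k) j; first by rewrite tpermR tpermL.
    by rewrite !tpermD // ?xpair_eqE ?eqxx //= eq_sym.
  by rewrite !perm1 tpermD //; apply: contra vh => /eqP[->].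
- move=> x y Ix Iy; rewrite /Q.
  (* A point constant on the fibre of the head is fixed by the relabellings, so there [Q] is a
     positive multiple of [P]. *)
  set z := fill _ y x.
  have zE s : z \o fibre_perm (pi s) = z.
    apply/funext => -[v i]; rewrite /z /fill /= /fibre_perm /= /pi.
    have memE j : ((v, j) \in [seq (ehead e, i0) | i0 <- enum 'I_d]) = (v == ehead e).
      apply/mapP/eqP => [[k _ []]//|->]; by exists j; rewrite ?mem_enum.
    by rewrite !memE; case: eqP => // _; rewrite perm1.
  under eq_bigr do rewrite zE.
  rewrite sumr_const mulrn_eq0 negb_or -lt0n; apply/andP; split.
    by apply/card_gt0P; exists 1%g.
  by apply: stP => w; rewrite /z /fill; case: ifP.
Qed.

End Coverings.

(** * Real-rootedness and parity of the averaged polynomial *)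

Section RealRooted.
Variables (R : realType) (G : mgraph) (d : nat).
Hypothesis G_loopless : loopless G.
Local Notation C := R[i].
Local Notation p := (d_matching_poly R d G).
Local Notation N := (#|vert G| * d)%N.

Lemma d_matching_horner (x : R) : p.[x] =
  (#|coverings d G|%:R)^-1 *
  \sum_tau mu (fun=> x) (@cedges G d tau (enum (gedge G))) [set: vert G * 'I_d]%SET.
Proof.
rewrite /d_matching_poly hornerZ horner_sum; congr (_ * _).
rewrite -sum_coverings; apply: eq_bigr => s _; exact: covering_horner.
Qed.

Lemma map_matching_poly (H : mgraph) :
  map_poly (real_complex R) (matching_poly R H) = matching_poly C H.
Proof.
rewrite /matching_poly rmorph_sum /=; apply: eq_bigr => i _.
by rewrite map_polyZ map_polyXn rmorphM rmorphXn rmorphN1 rmorph_nat.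
Qed.

Lemma map_d_matching_horner (z : C) : (map_poly (real_complex R) p).[z] =
  (#|coverings d G|%:R)^-1 * @avg_mu G d _ (enum (gedge G)) (fun=> z).
Proof.
rewrite /d_matching_poly map_polyZ hornerZ /avg_mu -sum_coverings; congr (_ * _).
  by rewrite fmorphV rmorph_nat.
rewrite rmorph_sum horner_sum /=; apply: eq_bigr => s _.
by rewrite map_matching_poly covering_horner.
Qed.

(** All exponents that occur have the parity of the number of vertices. *)
Lemma matching_poly_oppr (K : comNzRingType) (H : mgraph) (x : K) :
  (matching_poly K H).[- x] = (-1) ^+ #|vert H| * (matching_poly K H).[x].
Proof.
rewrite /matching_poly !horner_sum mulr_sumr; apply: eq_bigr => i _.
rewrite !hornerZ !hornerXn (exprNn x) [RHS]mulrCA.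
congr (_ * (_ * _)).
have i2 : (2 * i <= #|vert H|)%N by rewrite mul2n -geq_half_double -ltnS.
by rewrite -[in RHS](subnK i2) exprD mulnC exprM sqrr_sign mulr1.
Qed.

Lemma map_d_matching_oppr (z : C) :
  root (map_poly (real_complex R) p) (- z) = root (map_poly (real_complex R) p) z.
Proof.
rewrite !rootE.
have -> : (map_poly (real_complex R) p).[- z] = (-1) ^+ N * (map_poly (real_complex R) p).[z].
  rewrite /d_matching_poly map_polyZ !hornerZ mulrCA; congr (_ * _).
  rewrite rmorph_sum !horner_sum mulr_sumr /=; apply: eq_bigr => s _.
  by rewrite map_matching_poly matching_poly_oppr card_prod card_ord.
by rewrite mulf_eq0 signr_eq0.
Qed.

Lemma d_matching_oppr (x : R) : root p (- x) = root p x.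
Proof.
rewrite -!(fmorph_root (real_complex R)) -map_d_matching_oppr.
by rewrite rmorphN opprK.
Qed.

Lemma d_matching_real_rooted : real_rooted p.
Proof.
have pos z : 0 < complex.Im z -> ~~ root (map_poly (real_complex R) p) z.
  move=> Iz; rewrite rootE map_d_matching_horner mulf_neq0 //.
    by rewrite invr_eq0 pnatr_eq0 -lt0n card_coverings_gt0.
  by apply: stable_avg_mu; rewrite ?enum_uniq.
(* A root in the lower half-plane is moved to the upper one by [z |-> - z], using parity. *)
move=> z zp; apply/eqP; case: ltgtP => // Iz.
  by have := pos (- z); rewrite raddfN oppr_gt0 map_d_matching_oppr zp => /(_ Iz).
by have := pos z Iz; rewrite zp.
Qed.

End RealRooted.

(** * The root bound *)

Section RatioBound.
Variables (R : realFieldType) (G : mgraph) (x : R).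

(* The ratio of the matching polynomials of the depth-n tree hanging from the
   head of [a], without and with its root. *)
Fixpoint ratio n (a : dart G) : R :=
  if n is n'.+1 then
    (x - \sum_(b | (dtail b == dhead a) && (b != drev a)) ratio n' b)^-1
  else 0.

(** The expression is the denominator of a ratio in which no dart is excluded, as is the case at the
    root [v] of the universal cover. *)
Definition tree_positive n :=
  forall v : vert G, 0 < x - \sum_(b | dtail b == v) ratio n b.

Lemma ratio_denom_gt0 n a : (forall b, 0 <= ratio n b) -> tree_positive n ->
  0 < x - \sum_(b | (dtail b == dhead a) && (b != drev a)) ratio n b.
Proof.
move=> r0 pos; apply: lt_le_trans (pos (dhead a)) _.
rewrite lerD2l lerN2 [leRHS](bigID (fun b => b != drev a)) /= lerDl.
exact: sumr_ge0.
Qed.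

Lemma ratio_ge0 n a : (forall k, (k < n)%N -> tree_positive k) -> 0 <= ratio n a.
Proof.
elim: n a => //= n IH a pos; rewrite invr_ge0 ltW // ratio_denom_gt0 //; last exact: pos.
by move=> b; apply: IH => k kn; apply: pos; apply: ltnW.
Qed.

Variables (d : nat) (tau : {ffun gedge G -> 'S_d}).
Hypothesis G_loopless : loopless G.
Local Notation W := (vert G * 'I_d)%type.
Local Notation es := (cedges tau (enum (gedge G))).

(** The vertex reached from [(dtail b, i)] along the lift of [b]: the index [i] belongs to the fibre
    of the tail. *)
Definition lift_dart (b : dart G) (i : 'I_d) : W :=
  (dhead b, if b.2 then tau b.1 i else ((tau b.1)^-1)%g i).

Lemma lift_drev b i : lift_dart (drev b) (lift_dart b i).2 = (dtail b, i).
Proof. by case: b => e [] /=; rewrite /lift_dart /dhead /dtail /= ?permK ?permKV. Qed.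

Lemma mu_cedges_vertex (y : W -> R) (S : {set W}) v i : (v, i) \in S ->
  mu y es S = y (v, i) * mu y es (S :\ (v, i)) -
  \sum_(b | dtail b == v) (if lift_dart b i \in S :\ (v, i)
                           then mu y es (S :\ (v, i) :\ lift_dart b i) else 0).
Proof.
move=> vS; rewrite (mu_vertex _ _ vS); last first.
  by apply/allP => f /allpairsP[p [_ _ ->]]; rewrite xpair_eqE negb_and G_loopless.
congr (_ - _); set S' := S :\ _.
rewrite big_allpairs_dep big_enum [RHS]big_mkcond /=.
transitivity (\sum_(e : gedge G) \sum_(c : bool) (if dtail (e, c) == v then
    if lift_dart (e, c) i \in S' then mu y es (S' :\ lift_dart (e, c) i) else 0 else 0));
  last by rewrite pair_bigA; apply: eq_bigr => -[].
apply: eq_bigr => e _; rewrite big_bool big_enum /= big_split /=; congr (_ + _).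
  rewrite (bigD1 i) //= big1 ?addr0 => [|j ji].
    by rewrite xpair_eqE eqxx andbT /dtail /=; case: eqP.
  by rewrite xpair_eqE (negPf ji) andbF.
rewrite (bigD1 (((tau e)^-1)%g i)) //= big1 ?addr0 => [|j ji].
  by rewrite permKV xpair_eqE eqxx andbT /dtail /=; case: eqP.
rewrite xpair_eqE [tau e j == i](_ : _ = false) ?andbF //.
by apply/eqP => ij; move: ji; rewrite -ij permK eqxx.
Qed.

(** The condition on [lift_dart (drev a) i] says that the vertex from which [a] arrives has been
    deleted, so expanding at the head of [a] only follows darts other than [drev a]. Each expansion
    deletes a vertex, hence depth [#|S|] suffices. Neighbours missing from [S] only help, as ratios
    are nonnegative. *)
Lemma mu_ratio n (S : {set W}) : (forall k, (k < n)%N -> tree_positive k) ->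
  (#|S| <= n)%N ->
  0 < mu (fun=> x) es S /\
  forall a i, (dhead a, i) \in S -> lift_dart (drev a) i \notin S ->
    mu (fun=> x) es (S :\ (dhead a, i)) <= ratio n a * mu (fun=> x) es S.
Proof.
have mu0 : 0 < mu (fun=> x) es (finset.set0 : {set W}).
  elim: es => [|e es' IH] /=; first by rewrite big_set0.
  by rewrite inE subr0.
elim: n S => [|n IH] S pos.
  rewrite leqn0 cards_eq0 => /eqP->; split=> // a i.
  by rewrite inE.
move=> Sn.
have posn : forall k, (k < n)%N -> tree_positive k.
  by move=> k kn; apply: pos; apply: ltnW.
have r0 b : 0 <= ratio n b by apply: ratio_ge0.
have step v i b : (v, i) \in S -> dtail b == v -> lift_dart b i \in S :\ (v, i) ->
    mu (fun=> x) es (S :\ (v, i) :\ lift_dart b i) <=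
    ratio n b * mu (fun=> x) es (S :\ (v, i)).
  move=> vS /eqP bv bS.
  have [] := IH (S :\ (v, i)) posn; first by move: Sn; rewrite (cardsD1 (v, i)) vS.
  move=> _ /(_ b (lift_dart b i).2); apply=> //.
  by rewrite lift_drev bv !inE eqxx.
have mupos v i : (v, i) \in S -> 0 < mu (fun=> x) es (S :\ (v, i)).
  move=> vS; apply: (IH (S :\ (v, i)) posn _).1.
  by move: Sn; rewrite (cardsD1 (v, i)) vS.
(* Used twice: with all darts leaving [v] for positivity, and without the reverse dart for the ratio
   bound. *)
have bnd v i (Q : pred (dart G)) : (v, i) \in S ->
    (forall b, dtail b == v -> ~~ Q b -> lift_dart b i \notin S) ->
    (x - \sum_(b | (dtail b == v) && Q b) ratio n b) * mu (fun=> x) es (S :\ (v, i))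
    <= mu (fun=> x) es S.
  move=> vS nQ; rewrite (mu_cedges_vertex _ vS) mulrBl lerD2l lerN2.
  rewrite mulr_suml [leLHS](bigID Q) /= [X in _ + X]big1 ?addr0; last first.
    move=> b /andP[bv nQb]; rewrite inE (negPf (nQ b bv nQb)) andbF //.
  apply: ler_sum => b /andP[bv Qb]; case: ifP => bS; first exact: step.
  by rewrite mulr_ge0 // ltW // mupos.
split.
  have [->|/set0Pn[[v i] vS]] := eqVneq S finset.set0; first exact: mu0.
  apply: lt_le_trans (bnd v i predT vS _) => //.
  rewrite mulr_gt0 ?mupos //; under eq_bigl do rewrite andbT.
  by apply: pos.
move=> a i aS aN /=; rewrite mulrC ler_pdivlMr; last first.
  by apply: ratio_denom_gt0 => //; apply: pos.
rewrite mulrC; apply: bnd => // b _; rewrite negbK => /eqP->.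
exact: aN.
Qed.

End RatioBound.

(** * The numerical range of the adjacency operator and its spectrum *)

Section SpectralTop.
Local Open Scope classical_set_scope.
Variables (R : realType) (T : choiceType) (r : rel T) (nbr : T -> seq T) (D : nat).
Hypothesis r_sym : symmetric r.
Hypothesis nbrP : forall u v, r u v -> u \in nbr v.
Hypothesis nbrD : forall v, (size (nbr v) <= D)%N.
Implicit Types (S : seq T) (f g h : T -> R).

Definition sqnorm S f := \sum_(v <- S) f v ^+ 2.

Definition adj_form S f g := \sum_(v <- S) \sum_(u <- S | r u v) f u * g v.

Definition adj_form_le (c : R) :=
  forall S f, uniq S -> adj_form S f f <= c * sqnorm S f.

Lemma adj_formC S f g : adj_form S f g = adj_form S g f.
Proof.
rewrite /adj_form (exchange_big_dep predT) //=; apply: eq_bigr => u _.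
by apply: eq_big => [v|v _]; rewrite 1?r_sym // mulrC.
Qed.

Lemma sqnorm_ge0 S f : 0 <= sqnorm S f.
Proof. by apply: sumr_ge0 => v _; apply: sqr_ge0. Qed.

Lemma sum_supp (Z : nmodType) S S' (F : T -> Z) : uniq S -> uniq S' ->
  {subset S <= S'} -> {in S', forall v, v \notin S -> F v = 0} ->
  \sum_(v <- S') F v = \sum_(v <- S) F v.
Proof.
move=> uS uS' SS' F0.
rewrite (bigID (mem S)) /= [X in _ + X]big1_seq ?addr0; last first.
  by move=> v /andP[vS vS']; apply: F0.
rewrite -big_filter.
apply: perm_big; apply: uniq_perm; rewrite ?filter_uniq // => v.
by rewrite mem_filter; case: (boolP (v \in S)) => //= /SS'.
Qed.

(** From [|f u * f v| <= (f u ^+ 2 + f v ^+ 2) / 2], since a vertex has at most [D] neighbours. *)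
Lemma adj_form_norm_le S f : uniq S -> `|adj_form S f f| <= D%:R * sqnorm S f.
Proof.
move=> uS.
have half : \sum_(v <- S) \sum_(u <- S | r u v) f v ^+ 2 <= D%:R * sqnorm S f.
  rewrite mulr_sumr; apply: ler_sum => v _.
  rewrite big_const_seq iter_addr_0 mulr_natl ler_wpMn2l ?sqr_ge0 // -size_filter.
  apply: leq_trans (nbrD v); apply: uniq_leq_size; rewrite ?filter_uniq // => u.
  by rewrite mem_filter => /andP[/nbrP].
have half' : \sum_(v <- S) \sum_(u <- S | r u v) f u ^+ 2 <= D%:R * sqnorm S f.
  apply: le_trans half; rewrite (exchange_big_dep predT) //=.
  by under eq_bigr do under eq_bigl do rewrite r_sym.
have : `|adj_form S f f| <=
    \sum_(v <- S) \sum_(u <- S | r u v) (f u ^+ 2 / 2 + f v ^+ 2 / 2).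
  apply: le_trans (ler_norm_sum _ _ _) _; apply: ler_sum => v _.
  apply: le_trans (ler_norm_sum _ _ _) _; apply: ler_sum => u _.
  rewrite normrM -(real_normK (num_real (f u))) -(real_normK (num_real (f v))).
  by have := sqr_ge0 (`|f u| - `|f v|); lra.
move/le_trans; apply.
have dist (F : T -> T -> R) : \sum_(v <- S) \sum_(u <- S | r u v) F u v / 2 =
    (\sum_(v <- S) \sum_(u <- S | r u v) F u v) / 2.
  by rewrite mulr_suml; apply: eq_bigr => v _; rewrite mulr_suml.
under eq_bigr do rewrite big_split /=.
rewrite big_split /= (dist (fun u _ => f u ^+ 2)) (dist (fun _ v => f v ^+ 2)).
by lra.
Qed.

Definition complexify f : T -> R[i] := fun v => (f v)%:C%C.

Lemma l2norm_complexify S f : uniq S -> (forall v, v \notin S -> f v = 0) ->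
  l2norm_sqr (complexify f) = (sqnorm S f)%:E.
Proof.
move=> uS f0; rewrite /l2norm_sqr.
have -> : (fun v => (ComplexField.Normc.normc (complexify f v) ^+ 2)%:E) = (fun v => (f v ^+ 2)%:E).
  apply/funext => v; rewrite /complexify /= expr0n addr0 sqrtr_sqr real_normK ?num_real //.
rewrite (_ : \esum_(v in [set: T]) _ = \esum_(v in [set` S]) (f v ^+ 2)%:E).
  rewrite esum_fset //; last by move=> v _; rewrite lee_fin sqr_ge0.
  by rewrite -fsbig_seq // sumEFin.
rewrite [RHS]esum_mkcond; apply: eq_esum => v _.
case: ifPn => //; rewrite mem_setE => vS; rewrite f0 ?expr0n //.
Qed.

Lemma adj_operator_complexify S f v : uniq S -> (forall v, v \notin S -> f v = 0) ->
  adj_operator r (complexify f) v = (\sum_(u <- S | r u v) f u)%:C%C.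
Proof.
move=> uS f0; rewrite /adj_operator rmorph_sum /= (@fsbigE _ _ _ _ _ [seq u <- S | r u v]) ?filter_uniq //.
- rewrite big_filter_cond; apply: eq_bigl => u.
  by case: (boolP (r u v)) => //= ruv; rewrite mem_setE.
- by move=> u /=; rewrite mem_filter => /andP[].
- by move=> u /= ruv; rewrite mem_filter ruv /complexify /= => /f0 ->.
Qed.

Lemma adj_form_supp S S' f g : uniq S -> uniq S' -> {subset S <= S'} ->
  (forall v, v \notin S -> f v = 0) ->
  adj_form S' f g = \sum_(v <- S') (\sum_(u <- S | r u v) f u) * g v.
Proof.
move=> uS uS' SS' f0; apply: eq_bigr => v _; rewrite -mulr_suml; congr (_ * _).
rewrite big_mkcond [RHS]big_mkcond; apply: sum_supp => // u _ /f0 ->.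
by case: ifP.
Qed.

(* The top of the numerical range is an approximate eigenvalue: for a
   semidefinite operator B, |B f|^2 is bounded by <B f, f> times its norm. *)
Lemma resolvent_gap (c : R) : adj_form_le c ->
  in_resolvent (@adj_operator R T r) c%:C%C -> exists2 e, 0 < e & adj_form_le (c - e).
Proof.
move=> cle [B [[_ [M BM]] _ BK]].
(* [C] bounds the form of [c - A], and [M'] is a positive bound for the squared norm of the
   resolvent. *)
pose C := `|c| + D%:R + 1; pose M' := Num.max M 1.
have C0 : 0 < C by rewrite ltr_wpDl // addr_ge0.
have M'0 : 0 < M' by rewrite lt_max ltr01 orbT.
exists (M' * C)^-1; first by rewrite invr_gt0 mulr_gt0.
move=> S f' uS.
pose f v := if v \in S then f' v else 0.
have f0 v : v \notin S -> f v = 0 by rewrite /f => /negPf->.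
pose A v := \sum_(u <- S | r u v) f u.
pose g v := c * f v - A v.
(* The neighbours of [S] are added so that [g], which is [(c - A) f], is supported in [S']. *)
pose S' := undup (S ++ flatten [seq nbr u | u <- S]).
have uS' : uniq S' by apply: undup_uniq.
have SS' : {subset S <= S'} by move=> v vS; rewrite mem_undup mem_cat vS.
have g0 v : v \notin S' -> g v = 0.
  move=> vS'; rewrite /g f0 ?mulr0 ?sub0r; last by apply: contra vS' => /SS'.
  rewrite /A big1_seq ?oppr0 // => u /andP[ruv uS1].
  case/negP: vS'; rewrite mem_undup mem_cat; apply/orP; right.
  by apply/flattenP; exists (nbr u); [apply: map_f|apply: nbrP; rewrite r_sym].
have nf : sqnorm S f' = sqnorm S' f.
  rewrite /sqnorm (@sum_supp _ S S') //; last by move=> v _ /f0->; rewrite expr0n.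
  by apply: eq_big_seq => v vS; rewrite /f vS.
have qff : adj_form S f' f' = adj_form S' f f.
  rewrite (@adj_form_supp S S' f f) // (@sum_supp _ S S') //; last by move=> v _ /f0->; rewrite mulr0.
  rewrite /adj_form; apply: eq_big_seq => v vS; rewrite {2}/f vS mulr_suml.
  by rewrite big_seq_cond [RHS]big_seq_cond; apply: eq_bigr => u /andP[uS1 _]; rewrite /f uS1.
pose n := sqnorm S' g.
have qfg : c * (\sum_(v <- S') f v * g v) - adj_form S' f g = n.
  rewrite (@adj_form_supp S S' f g) // mulr_sumr -sumrB; apply: eq_bigr => v _.
  by rewrite mulrA -mulrBl.
have Bg : sqnorm S' f <= M' * n.
  have gE : (fun u =>
      adj_operator r (complexify f) u - c%:C%C * complexify f u) = complexify (fun u => - g u).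
    apply/funext => u; rewrite (@adj_operator_complexify S) // /complexify -rmorphM -rmorphB.
    by rewrite /g opprB.
  have fl2 : in_l2 (complexify f).
    by rewrite /in_l2 (@l2norm_complexify S') ?ltry // => v vS'; rewrite f0 //; apply: contra vS' => /SS'.
  have ng0 v : v \notin S' -> - g v = 0 by move=> /g0->; rewrite oppr0.
  have := BM (complexify (fun u => - g u)); rewrite /in_l2 (@l2norm_complexify S') // ltry => /(_ isT).
  rewrite -gE (_ : B _ = complexify f); last by apply/funext => v; apply: BK.
  rewrite (@l2norm_complexify S') //; last by move=> v vS'; rewrite f0 //; apply: contra vS' => /SS'.
  rewrite -EFinM lee_fin => /le_trans; apply.
  have -> : sqnorm S' (fun u => - g u) = n by apply: eq_bigr => v _; rewrite sqrrN.
  by rewrite ler_wpM2r ?sqnorm_ge0 // le_max lexx.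
(* Semidefiniteness of [c - A] on [f - t g] reads [q - 2 t n + t^2 <(c - A) g, g> >= 0], where
   [q = <(c - A) f, f>]. The last inner product is at most [C n], and [t = C^-1] then gives
   [n <= C q]. *)
pose t := C^-1.
have := cle S' (fun v => f v - t * g v) uS'.
have -> : sqnorm S' (fun v => f v - t * g v) =
    sqnorm S' f - 2 * t * (\sum_(v <- S') f v * g v) + t ^+ 2 * n.
  rewrite /sqnorm /n !mulr_sumr -sumrB -big_split; apply: eq_bigr => v _ /=; ring.
have -> : adj_form S' (fun v => f v - t * g v) (fun v => f v - t * g v) =
    adj_form S' f f - 2 * t * adj_form S' f g + t ^+ 2 * adj_form S' g g.
  have -> : adj_form S' f f - 2 * t * adj_form S' f g + t ^+ 2 * adj_form S' g g =
    adj_form S' f f - t * adj_form S' f g - t * adj_form S' g f + t ^+ 2 * adj_form S' g g.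
    by rewrite [adj_form S' g f]adj_formC; ring.
  rewrite /adj_form !mulr_sumr -!sumrB -big_split; apply: eq_bigr => v _ /=.
  rewrite !mulr_sumr -!sumrB -big_split; apply: eq_bigr => u _ /=; ring.
have gg : - adj_form S' g g <= D%:R * n.
  by apply: le_trans (adj_form_norm_le g uS'); rewrite ler_normr lexx orbT.
rewrite qff nf.
have n0 : 0 <= n by apply: sqnorm_ge0.
have cc : c * n <= `|c| * n by rewrite ler_wpM2r // ler_norm.
have t0 : 0 < t by rewrite invr_gt0.
move: (adj_form S' f f) (adj_form S' g g) (adj_form S' f g) qfg gg => qf qg qfg' qfgE gg.
move: (sqnorm S' f) Bg (\sum_(v <- S') _) qfgE => nf' Bg fg qfgE H.
have H1 : n <= C * (c * nf' - qf).
  have tC : t * C = 1 by rewrite mulVf // gt_eqF.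
  have : t ^+ 2 * (c * n - qg) <= t ^+ 2 * (C * n).
    by rewrite ler_pM2l ?exprn_gt0 // /C; lra.
  have -> : t ^+ 2 * (C * n) = t * n by rewrite -[RHS]mul1r -tC; ring.
  move=> H2.
  have : t * n <= c * nf' - qf.
    have : 2 * t * (c * fg - qfg') = 2 * t * n by rewrite qfgE.
    by move: H H2; rewrite !mulrDr; lra.
  by rewrite -(ler_pM2l C0) mulrA [C * t]mulrC tC mul1r.
have H2 : nf' <= M' * C * (c * nf' - qf).
  by apply: le_trans Bg _; rewrite -mulrA ler_pM2l.
rewrite -ler_pdivrMl ?mulr_gt0 // in H2.
by rewrite mulrBl; lra.
Qed.

(** The least admissible constant [c] lies in the spectrum, since otherwise [resolvent_gap] would
    lower it. Hence [c] is at most the spectral radius. *)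
Lemma spectral_radius_adj_form (t0 : T) (x : R) :
  (spectral_radius (@adj_operator R T r) < x%:E)%E ->
  exists2 c, c < x & adj_form_le c.
Proof.
move=> rx.
pose U := [set c : R | adj_form_le c].
have UD : U D%:R by move=> S f uS; apply: le_trans (adj_form_norm_le f uS); apply: ler_norm.
(* Testing on the single vertex [t0] bounds the admissible constants from below. *)
have U0 : lbound U (- D%:R).
  move=> c cU; have := cU [:: t0] (fun=> 1) isT.
  have := @adj_form_norm_le [:: t0] (fun=> 1) isT.
  have -> : sqnorm [:: t0] (fun=> 1) = 1 by rewrite /sqnorm big_seq1 expr1n.
  rewrite !mulr1 => h1 h2; have := lerNnormlW h1.
  by lra.
pose c := inf U.
have cU : adj_form_le c.
  move=> S f uS; apply/ler_addgt0Pr => e e0.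
  have n1 : 0 < sqnorm S f + 1 by rewrite ltr_wpDl ?sqnorm_ge0.
  have infU : has_inf U by split; [exists D%:R|exists (- D%:R)].
  have [c' c'U c'c] := inf_adherent (divr_gt0 e0 n1) infU.
  apply: le_trans (c'U S f uS) _.
  apply: (@le_trans _ _ ((c + e / (sqnorm S f + 1)) * sqnorm S f)).
    by rewrite ler_wpM2r ?sqnorm_ge0 // ltW.
  rewrite mulrDl lerD2l mulrAC ler_pdivrMr // ler_pM2l // lerDl //.
exists c => //.
have cspec : spectrum (@adj_operator R T r) c%:C%C.
  move=> /(resolvent_gap cU) [e e0 ce].
  have : c <= c - e by apply: ge_inf => //; exists (- D%:R).
  by lra.
rewrite -lte_fin; apply: le_lt_trans rx.
apply: (@le_trans _ _ (ComplexField.Normc.normc c%:C%C)%:E).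
  by rewrite lee_fin /= expr0n addr0 sqrtr_sqr ler_norm.
by apply: ereal_sup_ubound; exists c%:C%C.
Qed.

End SpectralTop.

(** * The universal covering tree: change of base point and test functions *)

Section UniversalCover.
Variables (R : realType) (G : mgraph) (x : R).
Implicit Types (v : vert G) (a b : dart G) (w : seq (dart G)).

Lemma drevK : involutive (@drev G).
Proof. by case=> e c; rewrite /drev /= negbK. Qed.

Lemma dtail_drev a : dtail (drev a) = dhead a.
Proof. by case: a => e []. Qed.

Lemma dhead_drev a : dhead (drev a) = dtail a.
Proof. by case: a => e []. Qed.

Lemma nb_walk_rcons2 v w a b : nb_walk v (rcons (rcons w a) b) =
  [&& nb_walk v (rcons w a), dtail b == dhead a & b != drev a].
Proof.
have isw : is_walk v (rcons (rcons w a) b) = is_walk v (rcons w a) && (dtail b == dhead a).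
  elim: w v => [|c w IH] v /=; first by rewrite !andbT.
  by rewrite IH andbA.
rewrite /nb_walk isw -!andbA; congr (_ && _); rewrite andbCA; congr (_ && _).
by case: w {isw} => [|c w]; rewrite /= ?andbT // rcons_path last_rcons.
Qed.

Lemma nb_walk_rcons v w a : nb_walk v (rcons w a) -> nb_walk v w.
Proof. by case: (lastP w) => // w' b; rewrite nb_walk_rcons2 => /and3P[]. Qed.

Lemma utree_adj_sym v : symmetric (@utree_adj G v).
Proof. by move=> s t; apply: eq_existsb => a; rewrite orbC. Qed.

(** A list containing the neighbours of [s]; at the root its first entry is the root itself. *)
Definition utree_nbr v (s : utree v) : seq (utree v) :=
  pmap insub (take (size (val s)).-1 (val s) :: [seq rcons (val s) a | a <- enum (dart G)]).

Lemma utree_nbrP v (s t : utree v) : utree_adj s t -> s \in utree_nbr t.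
Proof.
move=> /existsP[a st]; rewrite /utree_nbr mem_pmap_sub inE; apply/orP.
case/orP: st => /eqP ->; [left|right]; last by rewrite map_f ?mem_enum.
by rewrite size_rcons /= -cats1 take_size_cat.
Qed.

Lemma size_utree_nbr v (s : utree v) : (size (utree_nbr s) <= #|dart G|.+1)%N.
Proof.
rewrite size_pmap; apply: leq_trans (count_size _ _) _.
by rewrite /= size_map -cardE.
Qed.

(** Restricted to nonnegative functions, so that a change of base point only has to preserve
    adjacency in one direction. *)
Definition tree_form_lt v := forall (S : seq (utree v)) (f : utree v -> R),
  uniq S -> (forall s, 0 <= f s) -> 0 < sqnorm S f ->
  adj_form (@utree_adj G v) S f f < x * sqnorm S f.

(* The walk from the tail of [a] homotopic to [a] followed by [w]. *)
Definition rebase a w :=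
  if w is b :: w' then if b == drev a then w' else a :: w else [:: a].

Lemma nb_rebase a v v' w : dtail a = v -> dhead a = v' ->
  nb_walk v' w -> nb_walk v (rebase a w).
Proof.
move=> <- <-; rewrite /nb_walk; case: w => [|b w] /=; first by rewrite eqxx.
case: (eqVneq b (drev a)) => [->|ba] /=.
  rewrite dhead_drev => /andP[/andP[_ ->]] /=.
  by case: w => //= c w /andP[_ ->].
by rewrite eqxx ba.
Qed.

Lemma rebaseK a w v : nb_walk v w -> rebase (drev a) (rebase a w) = w.
Proof.
case: w => [|b w] /=; first by rewrite drevK eqxx.
case: eqVneq => [->|ba] /=; last by rewrite drevK eqxx.
case: w => [|c w] //= /andP[_ /= /andP[]].
by rewrite drevK => /negPf->.
Qed.

Definition utree_rebase a v v' (av : dtail a = v) (av' : dhead a = v')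
    (s : utree v') : utree v :=
  exist _ (rebase a (val s)) (nb_rebase av av' (valP s)).

Lemma utree_adj_rebase a v v' (av : dtail a = v) (av' : dhead a = v') s t :
  utree_adj s t -> utree_adj (utree_rebase av av' s) (utree_rebase av av' t).
Proof.
wlog: s t / exists b, val t = rcons (val s) b.
  move=> H st; case/existsP: (st) => b /orP[/eqP tE|/eqP sE].
    by apply: H => //; exists b.
  by rewrite utree_adj_sym; apply: H; [exists b|rewrite utree_adj_sym].
case=> b tE _; apply/existsP; rewrite /= tE -[sval s]/(val s).
case: (val s) => [|c w] /=.
  case: eqVneq => [_|ba]; first by exists a; rewrite eqxx orbT.
  by exists b; rewrite eqxx.
by case: eqP => _; exists b; rewrite eqxx.
Qed.

Lemma tree_form_lt_dart a : tree_form_lt (dtail a) -> tree_form_lt (dhead a).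
Proof.
move=> H S f uS f0 Sf.
pose phi := @utree_rebase a _ _ erefl erefl.
pose psi := utree_rebase (dtail_drev a) (dhead_drev a).
have phiK : cancel phi psi by move=> s; apply: val_inj; apply: rebaseK (valP s).
have nS : sqnorm (map phi S) (f \o psi) = sqnorm S f.
  by rewrite /sqnorm big_map; apply: eq_bigr => s _; rewrite /= phiK.
rewrite -nS; apply: le_lt_trans (H _ (f \o psi) _ _ _).
- rewrite /adj_form big_map; apply: ler_sum => t _.
  rewrite big_map /= phiK [leLHS]big_mkcond [leRHS]big_mkcond; apply: ler_sum => s _; rewrite /= !phiK.
  case: ifP => [st|_]; first by rewrite utree_adj_rebase.
  by case: ifP => // _; rewrite mulr_ge0.
- by rewrite map_inj_uniq //; apply: can_inj phiK.
- by move=> s; apply: f0.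
- by rewrite nS.
Qed.

(** The spectral hypothesis concerns one base vertex, whereas [tree_positive] speaks of all of them;
    the bound is transported along a path of [G]. *)
Lemma tree_form_lt_connected v v' : gconnected G -> tree_form_lt v -> tree_form_lt v'.
Proof.
move=> /(_ v v')/connectP[p + ->]; elim: p v => //= u p IH v /andP[vu up] Hv.
apply: (IH u up); case/existsP: vu => e /orP[] /andP[/eqP ev /eqP eu].
  by rewrite -eu; apply: (@tree_form_lt_dart (e, true)); rewrite /dtail /= ev.
by rewrite -ev; apply: (@tree_form_lt_dart (e, false)); rewrite /dtail /= eu.
Qed.

(** The depth drops by one at each step; as ratios of depth 0 vanish, the weight is supported on the
    ball of radius [n]. *)
Fixpoint walk_weight n w : R :=
  if w is a :: w' then ratio x n a * walk_weight n.-1 w' else 1.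

Lemma walk_weight_rcons n w a :
  walk_weight n (rcons w a) = walk_weight n w * ratio x (n - size w) a.
Proof.
elim: w n => [|b w IH] n /=; first by rewrite subn0 mulr1 mul1r.
by rewrite IH mulrA; case: n => [|n] //=; rewrite !mul0r.
Qed.

Lemma walk_weight_long n w : (n < size w)%N -> walk_weight n w = 0.
Proof.
case: (lastP w) => // w' a; rewrite size_rcons ltnS walk_weight_rcons => nw.
by rewrite (eqP (_ : n - size w' == 0)%N) ?subn_eq0 // mulr0.
Qed.

Lemma walk_weight_ge0 n w : (forall k, (k < n)%N -> tree_positive G x k) ->
  0 <= walk_weight n w.
Proof.
elim: w n => //= a w IH n pos; rewrite mulr_ge0 ?ratio_ge0 // IH // => k kn.
by apply: pos; apply: leq_trans kn (leq_pred _).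
Qed.

Definition utree_ball v n : seq (utree v) :=
  pmap insub [seq val t | t <- enum {bseq n of dart G}].

Lemma utree_ball_uniq v n : uniq (utree_ball v n).
Proof. by rewrite pmap_sub_uniq // map_inj_uniq ?enum_uniq //; apply: val_inj. Qed.

Lemma mem_utree_ball v n s : (s \in utree_ball v n) = (size (val s) <= n)%N.
Proof.
rewrite mem_pmap_sub; apply/mapP/idP => [[t _ ->]|sn]; first exact: size_bseq.
by exists (Bseq sn); rewrite ?mem_enum.
Qed.

(** The neighbours of a walk are its parent and its one-step extensions. Those outside the ball have
    weight 0 and may be included. *)
Lemma sum_utree_nbr v n (t : utree v) : (size (val t) <= n)%N ->
  \sum_(s <- utree_ball v n | utree_adj s t) walk_weight n (val s) =
  (if val t is [::] then 0 else walk_weight n (take (size (val t)).-1 (val t))) +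
  walk_weight n (val t) *
    \sum_(b | nb_walk v (rcons (val t) b)) ratio x (n - size (val t)) b.
Proof.
move: (valP t); set w := val t => wnb wn.
pose L := (if w is [::] then [::] else [:: take (size w).-1 w]) ++
  [seq rcons w b | b <- enum [pred b | nb_walk v (rcons w b)]].
pose A := [seq val s | s <- utree_ball v n & utree_adj s t].
have wE : w <> [::] -> exists p a, w = rcons p a /\ take (size w).-1 w = p.
  case: (lastP w) => // p a _; exists p, a; split=> //.
  by rewrite size_rcons /= -cats1 take_size_cat.
have memL s : s \in L -> nb_walk v s /\
    [exists a : dart G, (w == rcons s a) || (s == rcons w a)].
  rewrite mem_cat => /orP[|/mapP[b]].
    case: {-1}w (erefl w) => // c w' wc; rewrite inE -wc => /eqP->.
    have [|p [a [wpa ->]]] := wE; first by rewrite wc.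
    split; first by move: wnb; rewrite wpa => /nb_walk_rcons.
    by apply/existsP; exists a; rewrite wpa eqxx.
  rewrite mem_enum inE => nb ->; split=> //.
  by apply/existsP; exists b; rewrite eqxx orbT.
transitivity (\sum_(s <- A) walk_weight n s); first by rewrite big_map big_filter.
rewrite -(@sum_supp _ _ A L).
- rewrite big_cat /= big_map big_enum /= mulr_sumr; congr (_ + _).
    by case: (w) => [|c w']; rewrite ?big_nil ?big_seq1.
  by apply: eq_bigr => b _; apply: walk_weight_rcons.
- by rewrite map_inj_uniq ?filter_uniq ?utree_ball_uniq //; apply: val_inj.
- rewrite cat_uniq map_inj_uniq ?enum_uniq ?andbT; last by move=> b c /rcons_inj[].
  case: {-1}w (erefl w) => [|c w'] wc; first by rewrite has_pred0.
  rewrite /= -all_predC; apply/allP => s /mapP[b _ ->] /=.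
  rewrite inE -wc; apply/eqP => /(congr1 size).
  rewrite size_take wc /= size_rcons ltnSn => /esym/eqP.
  by rewrite ltn_eqF // ltnS leqnSn.
- move=> s /mapP[{}s + ->]; rewrite mem_filter => /andP[/existsP[a /orP[/eqP st|/eqP st]] _].
    rewrite mem_cat /w st; case E: (rcons (val s) a) => [|c w'].
      by move: E; case: (val s).
    by rewrite -E size_rcons /= -cats1 take_size_cat // mem_head.
  by rewrite mem_cat orbC st map_f // mem_enum inE -st (valP s).
- move=> s sL sA; apply: walk_weight_long; rewrite ltnNge; apply: contra sA => sn.
  have [snb sadj] := memL s sL.
  apply/mapP; exists (exist _ s snb : utree v) => //.
  by rewrite mem_filter mem_utree_ball sn andbT.
Qed.

(* Positivity at depth n is the quadratic form of x - A_T evaluated on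
   [walk_weight n], which (x - A_T) sends to a multiple of the
   root's indicator on the ball of radius n. *)
Lemma tree_positiveP : (forall v, tree_form_lt v) -> forall n, tree_positive G x n.
Proof.
move=> H n; elim/ltn_ind: n => n pos v.
pose S := utree_ball v n; pose f (s : utree v) := walk_weight n (val s).
have root_nb : nb_walk v [::] by [].
pose o : utree v := exist _ [::] root_nb.
have oS : o \in S by rewrite mem_utree_ball.
have f0 s : 0 <= f s by apply: walk_weight_ge0.
set D := x - _.
have key t : t \in S ->
    \sum_(s <- S | utree_adj s t) f s * f t = x * f t ^+ 2 - (if t == o then D else 0).
  rewrite mem_utree_ball -mulr_suml => tn; rewrite sum_utree_nbr //.
  have -> : (t == o) = (val t == [::]) by [].
  rewrite /f; move: (valP t) tn; case: (lastP (val t)) => [|p a] wnb wn.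
    rewrite /= !mul1r add0r mulr1 expr1n mulr1 subn0 /D opprB addrC subrK.
    by apply: eq_bigl => b; rewrite /nb_walk /= !andbT.
  have -> : (rcons p a == [::]) = false by case: (p).
  have -> : (if rcons p a is [::] then 0 else
      walk_weight n (take (size (rcons p a)).-1 (rcons p a))) = walk_weight n p.
    case E : (rcons p a) => [|c w']; first by case: (p) E.
    by rewrite -E size_rcons /= -cats1 take_size_cat.
  under eq_bigl do rewrite nb_walk_rcons2 wnb /=.
  rewrite walk_weight_rcons size_rcons subnS; rewrite size_rcons in wn.
  (* A positive depth lets the last ratio unfold to [(x - Q)^-1]. The parent then weighs [x - Q]
     times as much as [t], so the neighbours of [t] sum to [x] times its weight. *)
  have [k nk] : exists k, (n - size p = k.+1)%N.
    by exists (n - size p).-1; rewrite prednK // subn_gt0.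
  have kn : (k < n)%N by rewrite -nk leq_subr.
  rewrite nk /= subr0; set Q := \sum_(b | _) _.
  have Q0 : 0 < x - Q.
    apply: ratio_denom_gt0; last exact: pos.
    by move=> b; apply: ratio_ge0 => j jk; apply: pos; apply: ltn_trans kn.
  by field; rewrite gt_eqF.
have Sf : adj_form (@utree_adj G v) S f f = x * sqnorm S f - D.
  rewrite /adj_form big_seq (eq_bigr _ key) -big_seq sumrB -mulr_sumr; congr (_ - _).
  by rewrite (bigD1_seq o) ?utree_ball_uniq //= ?eqxx big1 ?addr0 // => t /negPf->.
(* The form equals [x * sqnorm S f - D], so the strict bound says [0 < D]; the norm is positive
   because the root has weight 1. *)
have := H v S f (utree_ball_uniq v n) f0; rewrite Sf gtrDl oppr_lt0; apply.
rewrite /sqnorm (bigD1_seq o) ?utree_ball_uniq //= ltr_pwDl //.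
  by rewrite /f /= expr1n.
by apply: sumr_ge0 => t _; apply: sqr_ge0.
Qed.

End UniversalCover.

(** * Conclusion: the roots lie between [- rho] and [rho] *)

Lemma d_matching_le_rho (R : realType) (G : mgraph) (x0 : vert G) (d : nat) (x : R) :
  gconnected G -> loopless G -> root (d_matching_poly R d G) x -> (x%:E <= rho R x0)%E.
Proof.
move=> Gc Gl; rewrite leNgt rootE => /eqP px; apply/negP => rx.
have [c cx cle] := spectral_radius_adj_form (@utree_adj_sym G x0)
  (@utree_nbrP G x0) (@size_utree_nbr G x0) (exist _ [::] isT : utree x0) rx.
have pos : forall n, tree_positive G x n.
  apply: tree_positiveP => v; apply: (tree_form_lt_connected Gc (v := x0)).
  move=> S f uS _ Sf; apply: le_lt_trans (cle S f uS) _.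
  by rewrite ltr_pM2r.
suff : 0 < (d_matching_poly R d G).[x] by rewrite px ltxx.
rewrite d_matching_horner // mulr_gt0 //.
  by rewrite invr_gt0 ltr0n card_coverings_gt0.
(* Splitting off the trivial covering makes the sum strictly positive. *)
rewrite (bigD1 [ffun=> 1%g]) //= ltr_pwDl //.
  by have [] := @mu_ratio R G x d [ffun=> 1%g] Gl _ [set: vert G * 'I_d]%SET (fun k _ => pos k) (leqnn _).
apply: sumr_ge0 => tau _; apply: ltW.
by have [] := @mu_ratio R G x d tau Gl _ [set: vert G * 'I_d]%SET (fun k _ => pos k) (leqnn _).
Qed.

Unset Implicit Arguments.

Theorem theorem2p7 (R : realType) (G : mgraph) (x0 : vert G)
    (G_connected : gconnected G) (G_loopless : loopless G)
    (d : nat) (d_gt0 : (0 < d)%N) :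
  real_rooted (d_matching_poly R d G) /\
  (forall x : R, root (d_matching_poly R d G) x ->
     (- rho R x0 <= x%:E)%E /\ (x%:E <= rho R x0)%E).
Proof.
split; first exact: d_matching_real_rooted.
move=> x px; split; last exact: d_matching_le_rho px.
rewrite leeNl -EFinN; apply: (@d_matching_le_rho _ _ _ d) => //.
by rewrite d_matching_oppr.
Qed.
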